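(* Let $\varepsilon,d$ be real numbers such that $0<\varepsilon<1/10$ and $20\varepsilon^{1/5}\le d<1/3$. Assume that $G=(V,E)$ is a $(1\pm\frac{d^4}{10})\rho$-regular graph on $n$ vertices with $\rho\ge 3d^{1/3}n$. Assume further that $H$ is a bipartite graph on $h$ vertices with maximum degree $D\ge1$. If - $n>2\exp(150\log(1/d)/\varepsilon^2)$, and - $h\le\frac{\varepsilon^{1/5}}{16D}\exp\left(-(D+101/\varepsilon^2)\log(1/d)\right)3^{-D}n$, then $G$ has an $H$-packing which covers all but at most $5d^{1/3}n$ vertices of $G$.
   Context: All graphs are simple and finite. For numbers $a\ge b$, a graph $G$ is $(a\pm b)$-regular if its minimum degree is at least $a-b$ and its maximum degree is at most $a+b$; thus $(1\pm\frac{d^4}{10})\rho$-regular means that all degrees lie in $[(1-\frac{d^4}{10})\rho,(1+\frac{d^4}{10})\rho]$. An $H$-packing in $G$ is a collection of vertex-disjoint copies of $H$ in $G$ (as not necessarily induced subgraphs). *)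

(* Defs.v *)
From mathcomp Require Import all_boot all_order all_algebra.
From mathcomp Require Import all_classical all_reals all_analysis.
Set Implicit Arguments.
Unset Strict Implicit.
Unset Printing Implicit Defensive.
Import Order.TTheory GRing.Theory Num.Theory.
Local Open Scope ring_scope.

Record sgraph := SGraph {
  vertex :> finType;
  adj : rel vertex;
  adj_sym : symmetric adj;
  adj_irrefl : irreflexive adj }.

Definition degree (G : sgraph) (x : G) : nat := #|[set y : G | adj x y]|.

Definition max_degree (G : sgraph) : nat := (\max_(x : G) degree x)%N.

Definition regular_pm (R : realType) (G : sgraph) (a b : R) : Prop :=
  forall x : G, a - b <= (degree x)%:R <= a + b.

Definition bipartite (H : sgraph) : Prop :=
  exists c : H -> bool, forall x y : H, adj x y -> c x != c y.

(* An embedding of H into G stands for the copy of H that is its image; only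
   edges, not non-edges, have to be preserved. *)
Definition embedding (H G : sgraph) (phi : {ffun H -> G}) : Prop :=
  injective phi /\ forall x y : H, adj x y -> adj (phi x) (phi y).

Definition copy_vertices (H G : sgraph) (phi : {ffun H -> G}) : {set G} :=
  [set phi x | x : H].

(* For H nonempty, disjointness forces distinct members of P to represent
   distinct copies. *)
Definition packing (H G : sgraph) (P : {set {ffun H -> G}}) : Prop :=
  (forall phi, phi \in P -> embedding phi) /\
  (forall phi psi, phi \in P -> psi \in P -> phi != psi ->
     [disjoint copy_vertices phi & copy_vertices psi]).

Definition covered (H G : sgraph) (P : {set {ffun H -> G}}) : {set G} :=
  (\bigcup_(phi in P) copy_vertices phi)%SET.

(* Main.v *)
(** Call a pair (A, B) of equal-sized vertex sets lower-regular if all its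
    subpairs of a fixed small relative size have density at least d/3.  By
    dependent random choice every such subpair contains H, so any disjoint,
    equally large A' in A and B' in B can be tiled almost completely by copies
    of H and of its reflection.  A density increment finds a lower-regular pair,
    of size at least a constant times n, in any two vertex sets of density d.

    Lower-regular pairs are then picked greedily, (A, B) possibly overlapping
    and with earlier pairs, so that almost all vertices are covered about equally
    often.  If c counts how often each vertex is covered so far and r is its
    mean, almost regularity of G gives an average of about 2r for c(x) + c(y)
    over the edges xy; discarding the edges between level sets of c of density
    below d, which are a proportion O(d^(2/3)) of all edges, leaves two levels
    i + j <= 2r + O(1) spanning density d, in which the next pair is taken.
    This makes the variance of c grow only linearly, so for r of order d^(-2/3)
    the relative deviation is O(d^(1/3)).  Giving each vertex weight
    1 / max(r, c) in every pair containing it, Hall's theorem rounds the cover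
    to disjoint balanced subpairs that miss O(d^(1/3) n) vertices. *)

Require Import Defs.
From mathcomp Require Import all_boot all_order all_algebra.
From mathcomp Require Import zify ring lra.
Set Implicit Arguments.
Unset Strict Implicit.
Unset Printing Implicit Defensive.
Import Order.TTheory GRing.Theory Num.Theory.

(** * Hall's theorem *)

(** Rado's argument: a set with two elements can lose one of them without violating Hall's
    condition. By induction on the total size all sets become singletons, which Hall's condition for
    pairs makes distinct. *)
Lemma hall_sdr (Q V : finType) (A : Q -> {set V}) :
  (forall J : {set Q}, #|J| <= #|\bigcup_(q in J) A q|) ->
  exists2 f : Q -> V, injective f & forall q, f q \in A q.
Proof.
have [k] := ubnP (\sum_q #|A q|); elim: k A => // k IHk A ltk hallA.
case: (pickP (fun q => 1 < #|A q|)) => [q0 /card_gt1P[x [y [xA yA neq_xy]]] | A_le1].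
  pose A' z q := if q == q0 then A q :\ z else A q.
  have A'sub z q : A' z q \subset A q by rewrite /A'; case: eqP; rewrite ?subD1set.
  have reduce z : z \in A q0 ->
      (forall J : {set Q}, #|J| <= #|\bigcup_(q in J) A' z q|) ->
      exists2 f : Q -> V, injective f & forall q, f q \in A q.
    move=> zA hallA'; have [|f f_inj fA] := IHk (A' z) _ hallA'.
      move: ltk; rewrite ltnS; apply: leq_trans.
      rewrite (bigD1 q0) //= [X in _ < X](bigD1 q0) //=.
      rewrite /A' eqxx [#|A q0|](cardsD1 z) zA add1n addSn ltnS leq_add2l.
      by apply: leq_sum => q /negPf->.
    by exists f => // q; apply: subsetP (A'sub z q) _ _.
  (* If deleting [z] from [A q0] breaks Hall's condition, a violating family must contain [q0]; [J]
     is the rest of that family. *)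
  have tight z : z \in A q0 ->
      ~~ [forall J : {set Q}, #|J| <= #|\bigcup_(q in J) A' z q|] ->
      exists J : {set Q}, q0 \notin J /\
        #|(\bigcup_(q in J) A q) :|: A q0 :\ z| <= #|J|.
    move=> zA /forallPn[J]; rewrite -ltnNge => ltJ.
    have q0J : q0 \in J.
      apply: contraLR ltJ => q0J; rewrite -leqNgt.
      rewrite (eq_bigr A) ?hallA // => q qJ; rewrite /A'; case: eqP => // eq_q.
      by rewrite -eq_q qJ in q0J.
    exists (J :\ q0); rewrite setD11; split=> //.
    move: ltJ; rewrite (cardsD1 q0 J) q0J add1n ltnS; apply: leq_trans.
    apply: subset_leq_card; apply/subsetP => v; rewrite inE => /orP[].
      case/bigcupP=> q; rewrite !inE => /andP[nq qJ] vA; apply/bigcupP.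
      by exists q => //; rewrite /A' (negPf nq).
    by move=> vA; apply/bigcupP; exists q0; rewrite // /A' eqxx.
  have [/forallP|/(tight x xA)[J1 [q0J1 leJ1]]] :=
    boolP [forall J : {set Q}, #|J| <= #|\bigcup_(q in J) A' x q|].
    exact: reduce.
  have [/forallP|/(tight y yA)[J2 [q0J2 leJ2]]] :=
    boolP [forall J : {set Q}, #|J| <= #|\bigcup_(q in J) A' y q|].
    exact: reduce.
  set X := (_ :|: _) in leJ1; set Y := (_ :|: _) in leJ2.
  (* As [x] and [y] differ, [X :|: Y] contains all of [A q0], whence the strict inequality. Together
     with [leI] it contradicts the modularity of cardinality. *)
  have leU : #|J1 :|: J2| < #|X :|: Y|.
    have := hallA (q0 |: (J1 :|: J2)); rewrite cardsU1 !inE negb_or q0J1 q0J2 add1n.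
    move/leq_trans; apply; apply: subset_leq_card; apply/subsetP => v.
    case/bigcupP=> q; rewrite !inE; case/orP=> [/eqP-> vA|].
      rewrite vA !andbT; case: (v =P x) => [->|_]; last by rewrite orbT.
      by rewrite neq_xy !orbT.
    by case/orP=> qJ vA; apply/orP; [left|right]; apply/orP; left;
      apply/bigcupP; exists q.
  have leI : #|J1 :&: J2| <= #|X :&: Y|.
    apply: leq_trans (hallA _) _; apply: subset_leq_card; apply/subsetP => v.
    case/bigcupP=> q; rewrite !inE => /andP[qJ1 qJ2] vA.
    by apply/andP; split; apply/orP; left; apply/bigcupP; exists q.
  by have := cardsUI X Y; have := cardsUI J1 J2; lia.
have A1 q : exists v, v \in A q.
  by have := hallA [set q]; rewrite cards1 big_set1 => /card_gt0P.
pose f q := xchoose (A1 q).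
have fA q : f q \in A q by apply: xchooseP.
exists f => // q q' eq_f; apply/eqP/negPn/negP => neq_q.
have := hallA [set q; q']; rewrite cards2 neq_q big_setU1 ?inE //= big_set1.
suff -> : A q :|: A q' = [set f q] by rewrite cards1.
have one p : A p = [set f p].
  apply/eqP; rewrite eq_sym eqEcard sub1set fA cards1 leqNgt.
  by have /= -> := A_le1 p.
by rewrite (one q) (one q') eq_f setUid.
Qed.

Local Open Scope ring_scope.

(** * Dependent random choice *)

(** Samples with repetition, kept as a list so that an average over random choices is a plain sum
    that splits off one letter at a time. *)
Fixpoint words (T : finType) (A : {set T}) (j : nat) : seq (seq T) :=
  if j is j'.+1 then [seq x :: s | x <- enum A, s <- words A j'] else [:: [::]].

Lemma size_words (T : finType) (A : {set T}) j : size (words A j) = (#|A| ^ j)%N.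
Proof. by elim: j => //= j IHj; rewrite size_allpairs IHj -cardE expnS. Qed.

Lemma sum_wordsS (T : finType) (A : {set T}) j (F : seq T -> nat) :
  (\sum_(s <- words A j.+1) F s = \sum_(x in A) \sum_(s <- words A j) F (x :: s))%N.
Proof. by rewrite /= big_allpairs_dep big_enum. Qed.

Lemma sum_words_setI (T : finType) (A B : {set T}) j (F : seq T -> nat) :
  (\sum_(s <- words (A :&: B) j) F s =
   \sum_(s <- words A j) all [in B] s * F s)%N.
Proof.
elim: j F => [|j IHj] F; first by rewrite !big_seq1 mul1n.
rewrite !sum_wordsS big_mkcond [RHS]big_mkcond; apply: eq_bigr => x _.
rewrite inE; case: (x \in A) => //=; case: ifP => xB.
  by rewrite IHj; apply: eq_bigr => s _.
by rewrite big1.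
Qed.

Lemma count_words (T : finType) (A B : {set T}) j :
  (\sum_(s <- words A j) all [in B] s = #|A :&: B| ^ j)%N.
Proof.
rewrite -size_words -sum1_size sum_words_setI.
by apply: eq_bigr => s _; rewrite muln1.
Qed.

(** A convex power lies above its tangent at [u]. Multiplying the bound for [k] by [t] leaves
    exactly the error [k.+1%:R * u ^+ k * (t - u) ^+ 2]. *)
Lemma tangent_expr (R : realFieldType) (t u : R) k :
  0 <= t -> 0 <= u -> k.+1%:R * u ^+ k * t - k%:R * u ^+ k.+1 <= t ^+ k.+1.
Proof.
move=> t0 u0; elim: k => [|k IHk]; first by rewrite expr0 expr1; lra.
have := ler_wpM2l t0 IHk; rewrite -exprS; apply: le_trans.
have u_k : 0 <= u ^+ k by rewrite exprn_ge0.
have sq : 0 <= k.+1%:R * u ^+ k * (t - u) ^+ 2.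
  by rewrite mulr_ge0 ?sqr_ge0 ?mulr_ge0 ?ler0n.
have -> : k.+2%:R = k.+1%:R + 1 :> R by rewrite -natr1.
move: sq; have -> : k.+1%:R = k%:R + 1 :> R by rewrite -natr1.
by rewrite !exprS expr0; lra.
Qed.

(** In the sum of the tangent bounds at [u], the linear terms contribute a nonnegative amount. *)
Lemma power_mean (R : realFieldType) (I : Type) (r : seq I) (P : pred I)
    (t : I -> R) (u : R) k :
  0 <= u -> (forall i, P i -> 0 <= t i) ->
  \sum_(i <- r | P i) u <= \sum_(i <- r | P i) t i ->
  \sum_(i <- r | P i) u ^+ k <= \sum_(i <- r | P i) t i ^+ k.
Proof.
case: k => [|k] u0 t0 le_ut; first exact: ler_sum.
have tan i : P i -> u ^+ k.+1 + k.+1%:R * u ^+ k * (t i - u) <= t i ^+ k.+1.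
  move=> Pi; apply: le_trans (tangent_expr k (t0 i Pi) u0).
  by rewrite exprS -natr1; lra.
apply: le_trans (ler_sum _ tan); rewrite big_split /= lerDl -mulr_sumr.
by rewrite mulr_ge0 ?mulr_ge0 ?exprn_ge0 // sumrB subr_ge0.
Qed.

(** The two sides may overlap; an edge inside the overlap counts twice. *)
Definition edges (G : sgraph) (A B : {set G}) : nat :=
  (\sum_(x in A) #|[set z in B | adj x z]|)%N.

Definition common (G : sgraph) (B : {set G}) (s : seq G) : {set G} :=
  [set z in B | all (adj z) s].

Lemma commonE (G : sgraph) (B : {set G}) s :
  common B s = B :&: [set z | all (adj z) s].
Proof. by apply/setP => z; rewrite !inE. Qed.

Lemma all_adjC (G : sgraph) (s w : seq G) :
  all [in [set z | all (adj z) w]] s = all [in [set z | all (adj z) s]] w.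
Proof.
transitivity (allrel (@adj G) s w).
  by apply: eq_all => x; rewrite inE.
rewrite allrelC; apply: eq_all => y; rewrite !inE; apply: eq_all => x.
exact: adj_sym.
Qed.

(** Averages over all words [w] of length [D] over [Y]. Convexity makes [#|common X w| ^ D] large on
    average, whereas a word with fewer than [h] common neighbours in [Y] lies in [common X w] for at
    most [h ^ D] choices of [w]. *)
Lemma dependent_random_choice (R : realFieldType) (G : sgraph) (X Y : {set G})
    (N D h : nat) (del : R) :
  #|X| = N -> #|Y| = N -> (0 < D)%N -> (0 < h)%N -> 0 <= del ->
  del * N%:R ^+ 2 <= (edges X Y)%:R -> (8 * D * h)%:R <= del ^+ D * N%:R ->
  exists w : seq G, (2 * h <= #|common X w|)%N /\
    ((2 * D) ^ D * \sum_(s <- words (common X w) D) (#|common Y s| < h)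
      < #|common X w| ^ D)%N.
Proof.
move=> cX cY D0 h0 del0 le_e le_h.
have N0 : (0 < N)%N.
  rewrite lt0n; apply: contraTneq le_h => ->; rewrite mulr0 -ltNge ltr0n.
  by rewrite !muln_gt0 D0 h0.
pose a w := #|common X w|.
pose b w := (\sum_(s <- words (common X w) D) (#|common Y s| < h))%N.
have [/hasP[w _ /andP[? ?]]|none] :=
  boolP (has (fun w => (2 * h <= a w) && ((2 * D) ^ D * b w < a w ^ D))%N (words Y D)).
  by exists w.
have le_ab w : w \in words Y D -> (a w ^ D <= (2 * h) ^ D + (2 * D) ^ D * b w)%N.
  move=> wY; have := hasPn none w wY; rewrite negb_and -ltnNge -leqNgt.
  case/orP=> [lt_a|le_a]; last by rewrite (leq_trans le_a) ?leq_addl.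
  by apply: leq_trans (leq_addr _ _); rewrite leq_exp2r // ltnW.
have sum_a : (\sum_(w <- words Y D) a w =
    \sum_(x in X) #|[set z in Y | adj x z]| ^ D)%N.
  transitivity (\sum_(w <- words Y D) \sum_(x in X) all (adj x) w)%N.
    apply: eq_bigr => w _; rewrite /a -sum1_card big_mkcond [RHS]big_mkcond.
    by apply: eq_bigr => x _; rewrite !inE; case: (x \in X) => //=; case: all.
  rewrite exchange_big; apply: eq_bigr => x _.
  have -> : [set z in Y | adj x z] = Y :&: [set z | adj x z].
    by apply/setP => z; rewrite !inE.
  rewrite -count_words; apply: eq_bigr => w _; congr nat_of_bool.
  by apply: eq_all => z; rewrite inE.
have sum_b : (\sum_(w <- words Y D) b w <= N ^ D * h ^ D)%N.
  have -> : (\sum_(w <- words Y D) b w =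
      \sum_(s <- words X D) (#|common Y s| < h) * #|common Y s| ^ D)%N.
    rewrite /b; under eq_bigr => w _ do rewrite {1}commonE sum_words_setI.
    rewrite exchange_big; apply: eq_bigr => s _.
    rewrite -big_distrl /= mulnC; congr (_ * _)%N.
    rewrite {1}commonE -count_words; apply: eq_bigr => w _.
    by rewrite all_adjC.
  apply: leq_trans (_ : \sum_(s <- words X D) h ^ D <= _)%N.
    apply: leq_sum => s _; case: ltnP => // /ltnW le_s.
    by rewrite mul1n leq_exp2r.
  by rewrite big_const_seq count_predT iter_addn_0 size_words cX mulnC.
have le_a1 : N%:R ^+ D * (del ^+ D * N%:R) <= \sum_(w <- words Y D) (a w)%:R :> R.
  rewrite -natr_sum sum_a natr_sum.
  under eq_bigr => x _ do rewrite natrX.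
  have pm : \sum_(x in X) (del * N%:R) ^+ D <=
      \sum_(x in X) #|[set z in Y | adj x z]|%:R ^+ D :> R.
    apply: power_mean; rewrite ?mulr_ge0 ?ler0n // -natr_sum.
    apply: le_trans le_e; rewrite sumr_const cX -[(del * _) *+ _]mulr_natr; lra.
  apply: le_trans pm; rewrite sumr_const cX -[_ ^+ _ *+ _]mulr_natr exprMn; lra.
have le_a2 : N%:R ^+ D * (del ^+ D * N%:R) ^+ D
    <= \sum_(w <- words Y D) (a w)%:R ^+ D :> R.
  have card_words (u : R) : \sum_(w <- words Y D) u = N%:R ^+ D * u.
    rewrite big_const_seq iter_addr_0 count_predT size_words cY.
    by rewrite -[u *+ _]mulr_natl natrX.
  rewrite -card_words; apply: power_mean => //.
    by rewrite mulr_ge0 ?exprn_ge0.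
  by rewrite card_words.
have le_a3 : (\sum_(w <- words Y D) a w ^ D <=
    N ^ D * (2 * h) ^ D + (2 * D) ^ D * (N ^ D * h ^ D))%N.
  apply: leq_trans (_ : \sum_(w <- words Y D) ((2 * h) ^ D + (2 * D) ^ D * b w) <= _)%N.
    by rewrite big_seq [X in (_ <= X)%N]big_seq; apply: leq_sum.
  rewrite big_split /= big_const_seq count_predT iter_addn_0 size_words cY mulnC.
  rewrite -big_distrr /= leq_add2l.
  by rewrite leq_mul2l sum_b orbT.
(* If no [w] works, summing [le_ab] gives this inequality. It is absurd: the left side is [4 ^ D]
   times [N ^ D * (2 * D * h) ^ D], the right side at most twice that. *)
suff : (N ^ D * (8 * D * h) ^ D <= N ^ D * (2 * h) ^ D + (2 * D) ^ D * (N ^ D * h ^ D))%N.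
  have ND : (0 < N ^ D)%N by rewrite expn_gt0 N0.
  have le1 : ((2 * h) ^ D <= (2 * D * h) ^ D)%N.
    by rewrite leq_exp2r // leq_mul2r leq_pmulr // orbT.
  rewrite mulnCA -mulnDr leq_pmul2l // -expnMn.
  have -> : (8 * D * h = 4 * (2 * D * h))%N by lia.
  rewrite [((4 * _) ^ D)%N]expnMn => le2.
  have : (4 ^ 1 <= 4 ^ D)%N by rewrite leq_exp2l.
  have : (0 < (2 * D * h) ^ D)%N by rewrite expn_gt0 !muln_gt0 D0 h0.
  by move: le1 le2; move: ((2 * D * h) ^ D)%N (4 ^ D)%N; nia.
have : (N ^ D * (8 * D * h) ^ D)%:R <= (\sum_(w <- words Y D) a w ^ D)%:R :> R.
  rewrite natr_sum; under [X in _ <= X]eq_bigr => w _ do rewrite natrX.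
  apply: le_trans le_a2 => /=; rewrite natrM !natrX ler_wpM2l ?exprn_ge0 ?ler0n //.
  by rewrite lerXn2r ?nnegrE ?mulr_ge0 ?exprn_ge0 ?ler0n.
by rewrite ler_nat => /leq_trans; apply.
Qed.

(** * Embedding bipartite graphs *)

(* The word [s] over [A] lists images of neighbours of one vertex of [H], in
   reverse order; [k] more are still to be chosen.  It fails if it has fewer than
   [h] common neighbours or too large a share of its one-letter extensions fails. *)
Fixpoint fails (G : sgraph) (Y A : {set G}) (D h k : nat) (s : seq G) : bool :=
  if k is k'.+1
  then (#|A| < 2 * D * #|[set v in A | fails Y A D h k' (v :: s)]|)%N
  else (#|common Y s| < h)%N.

(** Each level of the recursion loses a factor [2 * D]; hence failure of the empty word would
    contradict the count of bad words supplied by dependent random choice. *)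
Lemma fails_count (G : sgraph) (Y A : {set G}) D h k s :
  fails Y A D h k s ->
  (#|A| ^ k <= (2 * D) ^ k *
    \sum_(t <- words A k) (#|common Y (catrev t s)| < h))%N.
Proof.
elim: k s => [|k IHk] s /=; first by rewrite big_seq1 => /= ->.
set F := [set v in A | _] => ltA; rewrite -/(words A k.+1) sum_wordsS !expnS.
have: (#|F| * #|A| ^ k <= (2 * D) ^ k *
    \sum_(v in A) \sum_(t <- words A k) (#|common Y (catrev (v :: t) s)| < h))%N.
  rewrite -sum_nat_const big_distrr /= big_mkcond [leqRHS]big_mkcond /=.
  apply: leq_sum => v _; rewrite inE; case: (v \in A) => //=.
  by case: ifP => // /IHk.
rewrite -mulnA -(leq_pmul2l (_ : 0 < 2 * D)%N); last by lia.
by apply: leq_trans; rewrite mulnA leq_mul2r ltnW ?orbT.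
Qed.

(** Some extension of a word that does not fail does not fail either, and extending only shrinks the
    common neighbourhood. This serves vertices of degree below [D], whose words stay shorter than
    [D]. *)
Lemma not_fails_common (G : sgraph) (Y A : {set G}) D h k s :
  (0 < #|A|)%N -> (0 < D)%N -> ~~ fails Y A D h k s -> (h <= #|common Y s|)%N.
Proof.
move=> A0 D0; elim: k s => [|k IHk] s /=; rewrite -leqNgt // => le_F.
have /subsetPn[v vA nF] : ~~ (A \subset [set v in A | fails Y A D h k (v :: s)]).
  by apply/negP => /subset_leq_card; nia.
move: nF; rewrite inE vA => /IHk/leq_trans; apply; apply/subset_leq_card/subsetP => z.
by rewrite !inE /= => /and3P[-> _ ->].
Qed.

Lemma leq_card_bigcup (I T : finType) (P : pred I) (F : I -> {set T}) :
  (#|\bigcup_(i | P i) F i| <= \sum_(i | P i) #|F i|)%N.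
Proof.
elim/big_rec2: _ => [|i m B _ le_m]; first by rewrite cards0.
by rewrite (leq_trans (leq_card_setU _ _)) // leq_add2l.
Qed.

(* Vertices are placed one at a time; the sequence attached to [q] records the
   images of the neighbours of [q] placed so far and never becomes failing. *)
Lemma embed_in_core (G H : sgraph) (Y A : {set G}) D h (ps : seq H) :
  (0 < D)%N -> (0 < h)%N -> (forall x : H, (degree x <= D)%N) ->
  (2 * h <= #|A|)%N -> ~~ fails Y A D h D [::] ->
  uniq ps -> (size ps <= h)%N ->
  exists f : H -> G, [/\ {in ps, forall p, f p \in A}, {in ps &, injective f} &
    forall q, ~~ fails Y A D h (D - size (filter (adj q) ps))%N
                (map f (filter (adj q) ps))].
Proof.
move=> D0 h0 degD hA nfail; elim: ps => [|p ps IHps] /=.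
  have /card_gt0P[z _] : (0 < #|A|)%N by lia.
  by exists (fun _ => z); split=> // q; rewrite subn0.
case/andP=> p_ps uniq_ps size_ps.
have [f [fA f_inj f_ok]] := IHps uniq_ps (ltnW size_ps).
pose nb q := filter (adj q) ps.
(* The images for [p] that are forbidden on account of its neighbour [q]. *)
pose F q := [set v in A | fails Y A D h (D - (size (nb q)).+1)%N (v :: map f (nb q))].
have nbD q : adj q p -> (size (nb q) < D)%N.
  move=> qp; apply: leq_trans (degD q).
  have /card_uniqP <- : uniq (nb q) by apply: filter_uniq.
  apply: proper_card; apply/properP; split.
    by apply/subsetP => x; rewrite mem_filter inE => /andP[].
  by exists p; rewrite ?inE // mem_filter (negPf p_ps) andbF.
have leF q : adj q p -> (2 * D * #|F q| <= #|A|)%N.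
  move=> qp; have := f_ok q; rewrite -/(nb q) /F.
  have ltD := nbD q qp; have -> : (D - size (nb q) = (D - (size (nb q)).+1).+1)%N by lia.
  by rewrite /= -leqNgt.
pose B := \bigcup_(q | adj q p) F q.
(* At most [D] neighbours each forbid at most a [1 / (2 * D)] share of [A]. So half of [A], at least
   [h] vertices, stays allowed, and fewer than [h] are occupied. *)
have leB : (2 * #|B| <= #|A|)%N.
  have leB1 : (#|B| <= \sum_(q | adj q p) #|F q|)%N by apply: leq_card_bigcup.
  have : (2 * D * \sum_(q | adj q p) #|F q| <= D * #|A|)%N.
    rewrite big_distrr /=; apply: (@leq_trans (\sum_(q | adj q p) #|A|)%N).
      exact: leq_sum.
    rewrite sum_nat_const leq_mul2r; apply/orP; right; apply: leq_trans (degD p).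
    rewrite /degree cardsE; apply/eq_leq/eq_card => q.
    by rewrite !unfold_in /= adj_sym.
  by nia.
have [v vA] : exists2 v, v \in A & v \notin B :|: [set x in map f ps].
  apply/subsetPn/negP => /subset_leq_card.
  have := leq_card_setU B [set x in map f ps].
  have : (#|[set x in map f ps]| <= size ps)%N.
    by rewrite cardsE (leq_trans (card_size _)) ?size_map.
  by move=> h1 [h2 _] h3; lia.
rewrite !inE negb_or => /andP[vB vf].
pose f' x := if x == p then v else f x.
have f'E : {in ps, f' =1 f}.
  by move=> x xps; rewrite /f'; case: eqP => // eq_x; rewrite -eq_x xps in p_ps.
have f'p : f' p = v by rewrite /f' eqxx.
exists f'; split.
- by move=> x; rewrite inE => /predU1P[->|xps]; rewrite ?f'p // f'E // fA.
- move=> x y; rewrite !inE => /predU1P[->|xps] /predU1P[->|yps] //.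
  + by rewrite f'p f'E // => eq_v; rewrite eq_v map_f in vf.
  + by rewrite f'p f'E // => eq_v; rewrite -eq_v map_f in vf.
  + by rewrite !f'E //; apply: f_inj.
- move=> q; have eq_nb : map f' (nb q) = map f (nb q).
    by apply/eq_in_map => x; rewrite mem_filter => /andP[_ /f'E].
  case: ifP => qp /=; rewrite -/(nb q) eq_nb; last exact: f_ok.
  rewrite f'p; apply: contra vB => vF; apply/bigcupP; exists q => //.
  by rewrite inE vA.
Qed.

(** The class of colour false goes into the core [A] inside [X]. Every vertex of the other class
    then has at least [#|H|] candidates in [Y], so Hall's condition for distinct images is
    immediate. *)
Lemma bipartite_embedding (R : realFieldType) (G H : sgraph) (c : H -> bool)
    (X Y : {set G}) (N D : nat) (del : R) :
  (forall x y : H, adj x y -> c x != c y) -> (forall x : H, (degree x <= D)%N) ->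
  #|X| = N -> #|Y| = N -> [disjoint X & Y] -> (0 < D)%N -> (0 < #|H|)%N ->
  0 <= del -> del * N%:R ^+ 2 <= (edges X Y)%:R ->
  (8 * D * #|H|)%:R <= del ^+ D * N%:R ->
  exists2 phi : {ffun H -> G}, embedding phi &
    forall x, phi x \in if c x then Y else X.
Proof.
move=> cH degD cX cY dXY D0 h0 del0 le_e le_h.
have [w [hA lt_fail]] := dependent_random_choice cX cY D0 h0 del0 le_e le_h.
set A := common X w in hA lt_fail.
have nfail : ~~ fails Y A D #|H| D [::].
  apply/negP => /fails_count; rewrite leqNgt => /negP; apply.
  apply: leq_ltn_trans lt_fail; rewrite leq_mul2l; apply/orP; right.
  apply: leq_sum => t _; rewrite catrevE cats0 /common.
  by under eq_finset => z do rewrite all_rev.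
have size_ps : (size (enum [pred x | ~~ c x]) <= #|H|)%N by rewrite -cardE max_card.
have [f [fA f_inj f_ok]] :=
  embed_in_core D0 h0 degD hA nfail (enum_uniq [pred x | ~~ c x]) size_ps.
pose C q := common Y (map f (filter (adj q) (enum [pred x | ~~ c x]))).
have leC q : (#|H| <= #|C q|)%N by apply: not_fails_common (f_ok q); lia.
have [J|g g_inj gC] := @hall_sdr H G C.
  have [->|[q qJ]] := set_0Vmem J; first by rewrite cards0.
  apply: leq_trans (max_card _) (leq_trans (leC q) (subset_leq_card _)).
  exact: bigcup_sup.
have fX x : ~~ c x -> f x \in X.
  move=> cx; have /subsetP: A \subset X by apply/subsetP => z; rewrite inE => /andP[].
  by apply; apply: fA; rewrite mem_enum.
have gY x : g x \in Y by have := gC x; rewrite inE => /andP[].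
have fg x y : ~~ c x -> f x = g y -> False.
  move=> /fX xX eq_fg; move/pred0P/(_ (g y)): dXY => /=.
  by rewrite gY -eq_fg xX.
have fg_adj x y : ~~ c x -> adj y x -> adj (g y) (f x).
  move=> cx yx; have := gC y; rewrite inE => /andP[_ /allP]; apply.
  by apply: map_f; rewrite mem_filter yx mem_enum.
exists [ffun x => if c x then g x else f x].
  split=> x y; rewrite !ffunE.
    case: ifPn => cx; case: ifPn => cy //.
    - exact: g_inj.
    - by move/esym/(fg _ _ cy).
    - by move/(fg _ _ cx).
    - by move/f_inj; apply; rewrite mem_enum.
  move=> xy; have := cH x y xy; case: ifPn => cx; case: ifPn => cy // _.
    exact: fg_adj.
  by rewrite adj_sym fg_adj // adj_sym.
by move=> x; rewrite ffunE; case: ifPn => // /fX.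
Qed.

(** * Tiling a lower-regular pair *)

(** Discarding an element with the smallest [f] never lowers the average of [f]. *)
Lemma heavy_subset (T : finType) (X : {set T}) (f : T -> nat) q :
  (q <= #|X|)%N -> exists X1 : {set T}, [/\ X1 \subset X, #|X1| = q &
    (q * \sum_(x in X) f x <= #|X| * \sum_(x in X1) f x)%N].
Proof.
move=> le_q; have [k cX] : exists k, #|X| = (q + k)%N by exists (#|X| - q)%N; lia.
elim: k X cX {le_q} => [|k IHk] X cX; first by exists X; rewrite cX addn0.
have /card_gt0P[x1 x1X] : (0 < #|X|)%N by lia.
case: (@arg_minnP _ x1 [in X] f x1X) => x0 x0X min0.
have cX0 : #|X| = #|X :\ x0|.+1 by rewrite (cardsD1 x0) x0X.
have [|X1 [sX1 cX1 le1]] := IHk (X :\ x0); first by lia.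
exists X1; split=> //; first exact: subset_trans sX1 (subD1set _ _).
rewrite (big_setD1 x0) //=.
have : (#|X :\ x0| * f x0 <= \sum_(x in X :\ x0) f x)%N.
  rewrite -sum_nat_const; apply: leq_sum => x; rewrite inE => /andP[_ xX].
  exact: min0.
have le_q : (q <= #|X :\ x0|)%N by lia.
rewrite cX0; move: le1 le_q; set m := #|X :\ x0|; set u := (\sum_(_ in _ :\ _) _)%N.
case: (posnP m) => [->|m0] le1 le_q le_f; first by have -> : q = 0%N by lia.
by rewrite -(leq_pmul2l m0); nia.
Qed.

Lemma subset_of_card (T : finType) (X : {set T}) q :
  (q <= #|X|)%N -> exists2 X1 : {set T}, X1 \subset X & #|X1| = q.
Proof. by move/(heavy_subset (fun=> 0%N)) => [X1 [? ? _]]; exists X1. Qed.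

Definition tileable (G H : sgraph) (X : {set G}) (k : nat) : Prop :=
  exists P : {set {ffun H -> G}},
    [/\ packing P, covered P \subset X & (#|X :\: covered P| <= k)%N].

Lemma tileable_none (G H : sgraph) (X : {set G}) k :
  (#|X| <= k)%N -> tileable H X k.
Proof.
move=> le_X; exists set0; split.
- by split=> [phi|phi psi]; rewrite inE.
- by rewrite /covered big_set0 sub0set.
- by rewrite /covered big_set0 setD0.
Qed.

Lemma tileable_copy (G H : sgraph) (phi : {ffun H -> G}) :
  embedding phi -> tileable H (copy_vertices phi) 0.
Proof.
move=> emb; exists [set phi]; rewrite /covered big_set1 setDv cards0; split=> //.
by split=> [psi|psi psi']; rewrite !inE => /eqP-> // /eqP->; rewrite eqxx.
Qed.

Lemma coveredU (G H : sgraph) (P Q : {set {ffun H -> G}}) :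
  covered (P :|: Q) = covered P :|: covered Q.
Proof. exact: bigcup_setU. Qed.

Lemma tileableU (G H : sgraph) (X Y : {set G}) k l :
  tileable H X k -> tileable H Y l -> [disjoint X & Y] ->
  tileable H (X :|: Y) (k + l).
Proof.
move=> [P [[embP disP] sP leP]] [Q [[embQ disQ] sQ leQ]] dXY.
have cross phi psi : phi \in P -> psi \in Q ->
    [disjoint copy_vertices phi & copy_vertices psi].
  move=> phiP psiQ; apply: disjointWl (disjointWr _ dXY).
    exact: subset_trans (bigcup_sup phi phiP) sP.
  exact: subset_trans (bigcup_sup psi psiQ) sQ.
exists (P :|: Q); rewrite coveredU setUSS //; split=> //.
  split=> [phi|phi psi]; rewrite !inE.
    by case/orP; [apply: embP|apply: embQ].
  case/orP=> phiP /orP[] psiP neq; [exact: disP|exact: cross| |exact: disQ].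
  by rewrite disjoint_sym cross.
apply: leq_trans (leq_add leP leQ); apply: leq_trans (leq_card_setU _ _).
apply/subset_leq_card/subsetP => z; rewrite !inE negb_or.
by case: (z \in X); case: (z \in Y); case: (z \in covered P) => //=; case: (_ \in _).
Qed.

Definition lower_regular (R : realFieldType) (G : sgraph) (del : R) (N : nat)
    (A B : {set G}) : Prop :=
  forall A' B' : {set G}, A' \subset A -> B' \subset B -> #|A'| = N -> #|B'| = N ->
    del * N%:R ^+ 2 <= (edges A' B')%:R.

(** The exact numbers of vertices removed from the two sides are recorded, so that a copy followed
    by its reflection is seen to keep the sides equal. *)
Lemma place_copy (R : realFieldType) (G H : sgraph) (c : H -> bool)
    (A B A' B' : {set G}) (N D : nat) (del : R) :
  (forall x y : H, adj x y -> c x != c y) -> (forall x : H, (degree x <= D)%N) ->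
  (0 < D)%N -> (0 < #|H|)%N -> 0 <= del ->
  (8 * D * #|H|)%:R <= del ^+ D * N%:R ->
  lower_regular del N A B -> A' \subset A -> B' \subset B -> [disjoint A' & B'] ->
  (N <= #|A'|)%N -> (N <= #|B'|)%N ->
  exists Z : {set G}, [/\ tileable H Z 0, Z \subset A' :|: B',
    (#|A' :\: Z| + #|[set x | ~~ c x]| = #|A'|)%N &
    (#|B' :\: Z| + #|[set x | c x]| = #|B'|)%N].
Proof.
move=> cH degD D0 h0 del0 le_h reg sA sB dAB leA leB.
have [X sX cX] := subset_of_card leA; have [Y sY cY] := subset_of_card leB.
have dXY : [disjoint X & Y] := disjointWl sX (disjointWr sY dAB).
have le_e := reg X Y (subset_trans sX sA) (subset_trans sY sB) cX cY.
have [phi emb phiXY] :=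
  bipartite_embedding cH degD cX cY dXY D0 h0 del0 le_e le_h.
have phi_inj : injective phi by case: emb.
have phiA x : (phi x \in A') = ~~ c x.
  have := phiXY x; case: ifP => _ z; last exact: subsetP sX _ z.
  by apply/negP => zA; have /pred0P/(_ (phi x)) := dAB; rewrite /= zA (subsetP sY _ z).
have phiB x : (phi x \in B') = c x.
  have := phiXY x; case: ifP => _ z; first exact: subsetP sY _ z.
  by apply/negP => zA; have /pred0P/(_ (phi x)) := dAB; rewrite /= zA (subsetP sX _ z).
have count (C : {set G}) (p : pred H) : (forall x, (phi x \in C) = p x) ->
    (#|C :\: copy_vertices phi| + #|[set x | p x]| = #|C|)%N.
  move=> pC; rewrite -(cardsID (copy_vertices phi) C) addnC; congr (_ + _)%N.
  rewrite -(card_imset _ phi_inj); apply: eq_card => z; rewrite inE.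
  apply/imsetP/andP => [[x + ->]|[zC /imsetP[x _ eq_z]]].
    by rewrite inE -pC => ->; split=> //; apply: imset_f.
  by exists x; rewrite // inE -pC -eq_z.
exists (copy_vertices phi); split; [exact: tileable_copy| |exact: count|exact: count].
apply/subsetP => _ /imsetP[x _ ->]; rewrite inE phiA phiB.
by case: (c x).
Qed.

(* Embedding [H] together with its reflection keeps the two sides balanced. *)
Lemma tile_pair (R : realFieldType) (G H : sgraph) (A B A' B' : {set G})
    (N D : nat) (del : R) :
  bipartite H -> (forall x : H, (degree x <= D)%N) ->
  (0 < D)%N -> (0 < #|H|)%N -> 0 <= del ->
  (8 * D * #|H|)%:R <= del ^+ D * N%:R ->
  lower_regular del N A B -> A' \subset A -> B' \subset B -> [disjoint A' & B'] ->
  #|A'| = #|B'| -> tileable H (A' :|: B') (2 * (N + #|H|)).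
Proof.
move=> [c cH] degD D0 h0 del0 le_h reg.
have [k] := ubnP #|A'|; elim: k A' B' => // k IHk A' B' ltk sA sB dAB cAB.
have [lt_A|le_A] := ltnP #|A'| (N + #|H|).
  apply: tileable_none; have [le_U _] := leq_card_setU A' B'.
  by apply: leq_trans le_U _; move: lt_A cAB; clear; lia.
have cH' (x y : H) : adj x y -> ~~ c x != ~~ c y.
  by move/cH; case: (c x); case: (c y).
have sum_c : (#|[set x | c x]| + #|[set x | ~~ c x]| = #|H|)%N.
  by rewrite -(cardsC [set x | c x]); congr (_ + _)%N; apply: eq_card => x; rewrite !inE.
have [||Z [tZ sZ eA eB]] := place_copy cH degD D0 h0 del0 le_h reg sA sB dAB.
- by move: le_A; clear; lia.
- by move: le_A cAB; clear; lia.
have dAB1 : [disjoint A' :\: Z & B' :\: Z].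
  exact: disjointWl (subsetDl _ _) (disjointWr (subsetDl _ _) dAB).
have sA1 := subset_trans (subsetDl A' Z) sA.
have sB1 := subset_trans (subsetDl B' Z) sB.
(* The reflection uses the exchanged colouring. The first copy takes at most [#|H|] vertices, so [N]
   remain on each side; both copies together take exactly [#|H|] from each side. *)
have [||Z1 [tZ1 sZ1 eA1 eB1]] :=
  place_copy cH' degD D0 h0 del0 le_h reg sA1 sB1 dAB1.
- by move: le_A eA sum_c; clear; lia.
- by move: le_A cAB eB sum_c; clear; lia.
have eq_cc : #|[set x | ~~ ~~ c x]| = #|[set x | c x]|.
  by apply: eq_card => x; rewrite !inE negbK.
have tW := IHk ((A' :\: Z) :\: Z1) ((B' :\: Z) :\: Z1).
set W := _ :|: _ in tW.
have {}tW : tileable H W (2 * (N + #|H|)).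
  apply: tW; first by move: ltk h0 sum_c eA eA1 eq_cc; clear; lia.
  - exact: subset_trans (subsetDl _ _) sA1.
  - exact: subset_trans (subsetDl _ _) sB1.
  - exact: disjointWl (subsetDl _ _) (disjointWr (subsetDl _ _) dAB1).
  - by move: cAB eA eA1 eB eB1 eq_cc; clear; lia.
have -> : A' :|: B' = Z :|: (Z1 :|: W).
  apply/setP => z; have := subsetP sZ z; have := subsetP sZ1 z; rewrite !inE.
  by case: (z \in Z) => [_ /(_ isT)|]; case: (z \in Z1) => //=;
    case: (z \in A') => //=; case: (z \in B') => //= /(_ isT).
have dZ1W : [disjoint Z1 & W].
  by rewrite -setI_eq0; apply/eqP/setP => z; rewrite !inE; case: (z \in Z1) => //=.
have dZ : [disjoint Z & Z1 :|: W].
  rewrite -setI_eq0; apply/eqP/setP => z; have := subsetP sZ1 z; rewrite !inE.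
  by case: (z \in Z) => //=; rewrite ?andbF //=; case: (z \in Z1) => //= /(_ isT).
exact: tileableU tZ (tileableU tZ1 tW dZ1W) dZ.
Qed.

(** * Finding lower-regular pairs *)

Lemma edgesE (G : sgraph) (A B : {set G}) :
  edges A B = (\sum_(x in A) \sum_(z in B) adj x z)%N.
Proof.
apply: eq_bigr => x _; rewrite -sum1_card big_mkcond [RHS]big_mkcond.
by apply: eq_bigr => z _; rewrite inE; case: (z \in B) => //=; case: adj.
Qed.

Lemma edgesC (G : sgraph) (A B : {set G}) : edges A B = edges B A.
Proof.
rewrite !edgesE exchange_big; apply: eq_bigr => x _; apply: eq_bigr => z _.
by rewrite adj_sym.
Qed.

Lemma edges_le (G : sgraph) (A B : {set G}) : (edges A B <= #|A| * #|B|)%N.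
Proof.
rewrite -sum_nat_const; apply: leq_sum => x _.
by apply/subset_leq_card/subsetP => z; rewrite inE => /andP[].
Qed.

Lemma edges_splitl (G : sgraph) (A' A B : {set G}) : A' \subset A ->
  edges A B = (edges A' B + edges (A :\: A') B)%N.
Proof.
by move=> sA; rewrite {1}/edges (big_setID A') /= (setIidPr sA).
Qed.

(** One side is trimmed after the other by [heavy_subset], which preserves density. *)
Lemma dense_square (G : sgraph) (X Y : {set G}) q :
  (q <= #|X|)%N -> (q <= #|Y|)%N -> exists X1 Y1 : {set G},
  [/\ X1 \subset X, Y1 \subset Y, #|X1| = q, #|Y1| = q &
    (q ^ 2 * edges X Y <= #|X| * #|Y| * edges X1 Y1)%N].
Proof.
move=> leX leY.
have [X1 [sX cX le1]] := heavy_subset (fun x => #|[set z in Y | adj x z]|) leX.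
have [Y1 [sY cY le2]] := heavy_subset (fun y => #|[set z in X1 | adj y z]|) leY.
exists X1, Y1; split=> //; move: le1 le2; rewrite -!/(edges _ _).
rewrite (edgesC Y X1) (edgesC Y1 X1) => le1 le2.
rewrite expnS expn1 -mulnA; apply: leq_trans (_ : q * (#|X| * edges X1 Y) <= _)%N.
  by rewrite leq_mul2l le1 orbT.
by rewrite mulnCA -mulnA leq_mul2l le2 orbT.
Qed.

(** Limits the loss of size in a density increment: neither part of a split side falls below a
    [1 / L] share. *)
Lemma leq_mul_min_part m L : (4 <= L)%N -> ((m %/ L).+1 < m)%N ->
  (m <= L * minn (m %/ L).+1 (m - (m %/ L).+1))%N.
Proof.
move=> L4 ltm; have := ltn_ceil m (leq_trans _ L4 : 0 < L)%N.
have := leq_trunc_div m L; rewrite !(mulnC _ L) => le1 /(_ isT) lt2.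
move: ltm le1 lt2; rewrite /minn; case: ifP => _; first by lia.
by move: (m %/ L)%N => [|[|k]]; nia.
Qed.

(** A subpair of density below [del / 3] fills more than a [1 / L ^ 2] share of the area. Its
    deficit raises the density on one of the two rectangles forming the rest, and [dense_square]
    trims that rectangle to a square. *)
Lemma density_increment (R : realFieldType) (G : sgraph) (A B : {set G})
    (m L : nat) (del p : R) :
  #|A| = m -> #|B| = m -> (0 < m)%N -> (4 <= L)%N -> 0 < del -> del <= p ->
  p * m%:R ^+ 2 <= (edges A B)%:R ->
  lower_regular (del / 3) (m %/ L).+1 A B \/
  exists m1 (A1 B1 : {set G}), [/\ A1 \subset A /\ B1 \subset B,
    #|A1| = m1 /\ #|B1| = m1, (0 < m1)%N, (m <= L * m1)%N &
    (p + del / (2 * L%:R ^+ 2)) * m1%:R ^+ 2 <= (edges A1 B1)%:R].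
Proof.
move=> cA cB m0 L4 del0 le_p le_e; set N := (m %/ L).+1.
have ltmL : (m < L * N)%N by rewrite mulnC ltn_ceil // (leq_trans _ L4).
set g := del / (2 * L%:R ^+ 2).
have [/existsP[A' /existsP[B' /and5P[sA sB /eqP cA' /eqP cB' lt_e]]]|] := boolP
  [exists A' : {set G}, exists B' : {set G}, [&& A' \subset A, B' \subset B,
    #|A'| == N, #|B'| == N & (edges A' B')%:R < del / 3 * N%:R ^+ 2]]; last first.
  move=> none; left=> A' B' sA sB cA' cB'; rewrite leNgt; apply: contra none => lt_e.
  by apply/existsP; exists A'; apply/existsP; exists B'; rewrite sA sB cA' cB' !eqxx lt_e.
right.
have leN : (N <= m)%N by rewrite -cA' -cA subset_leq_card.
have N_gt0 : 0 < N%:R :> R by rewrite ltr0n.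
have ltNm : (N < m)%N.
  rewrite ltn_neqAle leN andbT; apply/eqP => eqN.
  have eqA : A' = A by apply/eqP; rewrite eqEcard sA cA cA' eqN leqnn.
  have eqB : B' = B by apply/eqP; rewrite eqEcard sB cB cB' eqN leqnn.
  move: lt_e; rewrite eqA eqB ltNge => /negP; apply; apply: le_trans le_e.
  by rewrite eqN ler_wpM2r ?sqr_ge0 //; lra.
have cAD : #|A :\: A'| = (m - N)%N by rewrite cardsD (setIidPr sA) cA cA'.
have cBD : #|B :\: B'| = (m - N)%N by rewrite cardsD (setIidPr sB) cB cB'.
have split_e : (edges A B)%:R =
    (edges A' B')%:R + (edges A' (B :\: B'))%:R + (edges (A :\: A') B)%:R :> R.
  rewrite -!natrD; congr (_%:R).
  by rewrite (edges_splitl _ sA) edgesC (edges_splitl _ sB) !(edgesC A').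
have L_gt0 : 0 < L%:R :> R by rewrite ltr0n; lia.
(* This determines the increment [g]: spread over the whole area it amounts to at most [del / 2] on
   the sparse subpair, where the deficit exceeds [2 * del / 3]. *)
have gE : g * m%:R ^+ 2 <= del / 2 * N%:R ^+ 2.
  have leLN : m%:R ^+ 2 <= (L%:R * N%:R) ^+ 2 :> R.
    by rewrite lerXn2r ?nnegrE ?mulr_ge0 ?ler0n // -natrM ler_nat ltnW.
  have -> : del / 2 * N%:R ^+ 2 = g * (L%:R * N%:R) ^+ 2.
    by rewrite /g; move: (N%:R) (L%:R) L_gt0 => x y y0; field; rewrite gt_eqF.
  by rewrite ler_wpM2l // /g divr_ge0 ?mulr_ge0 ?sqr_ge0 // ltW.
have g0 : 0 < g by rewrite divr_gt0 ?mulr_gt0 ?exprn_gt0.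
have finish (X Y : {set G}) : X \subset A -> Y \subset B ->
    (minn N (m - N) <= #|X|)%N -> (minn N (m - N) <= #|Y|)%N ->
    (p + g) * (#|X|%:R * #|Y|%:R) <= (edges X Y)%:R ->
    exists m1 (A1 B1 : {set G}), [/\ A1 \subset A /\ B1 \subset B,
      #|A1| = m1 /\ #|B1| = m1, (0 < m1)%N, (m <= L * m1)%N &
      (p + g) * m1%:R ^+ 2 <= (edges A1 B1)%:R].
  move=> sX sY leX leY le_XY.
  have [X1 [Y1 [sX1 sY1 cX1 cY1 le1]]] := dense_square leX leY.
  set q := minn N (m - N) in leX leY cX1 cY1 le1 *.
  have q0 : (0 < q)%N by rewrite leq_min subn_gt0 ltNm.
  exists q, X1, Y1; split=> //.
  - by split; [apply: subset_trans sX1 sX|apply: subset_trans sY1 sY].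
  - exact: leq_mul_min_part.
  have XY0 : 0 < #|X|%:R * #|Y|%:R :> R by rewrite mulr_gt0 // ltr0n (leq_trans q0).
  rewrite -(ler_pM2l XY0).
  have {}le1 : q%:R ^+ 2 * (edges X Y)%:R <= #|X|%:R * #|Y|%:R * (edges X1 Y1)%:R :> R.
    by rewrite -natrX -!natrM ler_nat.
  apply: le_trans le1; rewrite mulrCA mulrA mulrC.
  by rewrite ler_wpM2l ?sqr_ge0.
have mN : (m - N)%:R = m%:R - N%:R :> R by rewrite natrB.
have [le1|lt1] := lerP ((p + g) * (N%:R * (m%:R - N%:R))) (edges A' (B :\: B'))%:R.
  apply: (finish A' (B :\: B')); rewrite ?subsetDl ?cBD ?cA' ?geq_minl ?geq_minr //.
  by rewrite mN.
have [le2|lt2] := lerP ((p + g) * ((m%:R - N%:R) * m%:R)) (edges (A :\: A') B)%:R.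
  apply: (finish (A :\: A') B); rewrite ?subsetDl ?cAD ?cB ?geq_minr //.
    by rewrite geq_min ltnW.
  by rewrite mN.
exfalso; move: le_e; rewrite split_e => le_e.
have h1 : 0 <= (p - del) * N%:R ^+ 2 by rewrite mulr_ge0 ?sqr_ge0 ?subr_ge0.
have h2 : 0 < g * N%:R ^+ 2 by rewrite mulr_gt0 ?exprn_gt0.
have h3 : 0 < del * N%:R ^+ 2 by rewrite mulr_gt0 ?exprn_gt0.
move: gE lt_e lt1 lt2 le_e h1 h2 h3.
move: ((edges A' B')%:R : R) ((edges A' (B :\: B'))%:R : R)
  ((edges (A :\: A') B)%:R : R) (N%:R : R) (m%:R : R) (g : R).
move=> e1 e2 e3 x y z; clear; lra.
Qed.

(** Density cannot exceed 1, so at most [K] increments of [del / (2 * L ^ 2)] are possible, each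
    costing a factor at most [L] in size. *)
Lemma lower_regular_pair (R : realFieldType) (G : sgraph) (L K : nat) (del : R)
    (A B : {set G}) (m : nat) :
  #|A| = m -> #|B| = m -> (0 < m)%N -> (4 <= L)%N -> 0 < del ->
  del * m%:R ^+ 2 <= (edges A B)%:R -> 2 * L%:R ^+ 2 <= K%:R * del ->
  exists m1 (A1 B1 : {set G}), [/\ A1 \subset A /\ B1 \subset B,
    #|A1| = m1 /\ #|B1| = m1, (0 < m1)%N, (m <= L ^ K * m1)%N &
    lower_regular (del / 3) (m1 %/ L).+1 A1 B1].
Proof.
move=> cA cB m0 L4 del0 le_e leK.
have L_gt0 : 0 < L%:R :> R by rewrite ltr0n; lia.
pose g := del / (2 * L%:R ^+ 2).
have g0 : 0 < g by rewrite divr_gt0 ?mulr_gt0 ?exprn_gt0.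
have lt1 : 1 < del + K%:R * g.
  have : 1 <= K%:R * g by rewrite /g mulrA ler_pdivlMr ?mulr_gt0 ?exprn_gt0 // mul1r.
  by lra.
(* In the induction the current density [p] grows while the threshold [del] stays fixed. *)
have [p eq_p] : exists p, p = del by exists del.
move: (lexx del) le_e lt1; rewrite -{2 3 4}eq_p => {leK eq_p}.
elim: K A B m p cA cB m0 => [|k IHk] A B m p cA cB m0 le_p le_e lt1.
  have : (edges A B)%:R <= m%:R ^+ 2 :> R.
    by rewrite -natrX ler_nat (leq_trans (edges_le A B)) // cA cB.
  have : 0 < m%:R ^+ 2 :> R by rewrite exprn_gt0 ?ltr0n.
  by move=> m2 /(le_trans le_e); rewrite ger_pMl //; lra.
have [reg|[m1 [A1 [B1 [[sA sB] [cA1 cB1] m1_gt0 le_m le_e1]]]]] :=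
  density_increment cA cB m0 L4 del0 le_p le_e.
  exists m, A, B; split=> //; rewrite leq_pmull // expn_gt0.
  by apply/orP; left; lia.
have [|||m2 [A2 [B2 [[sA2 sB2] ? ? le_m2 reg]]]] :=
  IHk A1 B1 m1 (p + g) cA1 cB1 m1_gt0.
- by move: le_p g0; clear; lra.
- exact: le_e1.
- by move: lt1; rewrite -natr1; clear; lra.
exists m2, A2, B2; split=> //.
  by split; [apply: subset_trans sA2 sA|apply: subset_trans sB2 sB].
by rewrite expnS -mulnA (leq_trans le_m) // leq_mul2l le_m2 orbT.
Qed.

(** Otherwise edges between large levels with [i + j <= M], and edges meeting a small level, amount
    to at most [2 * del * #|G| ^ 2] ordered pairs. All other edges have [c x + c z > M], which
    exceeds the total that the degrees permit. *)
Lemma dense_light_levels (R : realFieldType) (G : sgraph) (c : G -> nat) (M : nat)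
    (lo hi del sig : R) :
  (forall x : G, lo <= (degree x)%:R <= hi) -> 0 <= del -> 0 <= sig ->
  2 * M.+1%:R * sig <= del ->
  2 * hi * (\sum_x c x)%:R < M.+1%:R * #|G|%:R * (lo - 2 * del * #|G|%:R) ->
  exists i j, let S k := [set x | c x == k] in
    [/\ (i + j <= M)%N, sig * #|G|%:R <= #|S i|%:R, sig * #|G|%:R <= #|S j|%:R &
      del * (#|S i|%:R * #|S j|%:R) <= (edges (S i) (S j))%:R].
Proof.
move=> deg_c del0 sig0 le_sig lt_hi; set n : R := #|G|%:R in lt_hi *.
pose S k := [set x | c x == k].
pose big k := sig * n <= #|S k|%:R.
pose good i j := [&& (i + j <= M)%N, big i & big j].
have [/existsP[i /existsP[j /andP[/and3P[? ? ?] ?]]]|none] := boolP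
  [exists i : 'I_M.+1, exists j : 'I_M.+1,
    good i j && (del * (#|S i|%:R * #|S j|%:R) <= (edges (S i) (S j))%:R)].
  by exists i, j.
exfalso.
have n0 : 0 <= n by apply: ler0n.
have sum1 (u : R) : \sum_(x : G) u = n * u by rewrite sumr_const mulr_natl.
have degE x : (degree x)%:R = \sum_(z : G) (adj x z)%:R :> R.
  rewrite /degree -sum1_card big_mkcond natr_sum; apply: eq_bigr => z _.
  by rewrite inE; case: adj.
have cardSE k : #|S k|%:R = \sum_(x : G) (c x == k)%:R :> R.
  rewrite -sum1_card big_mkcond natr_sum; apply: eq_bigr => z _.
  by rewrite inE; case: eqP.
have pick_level (u : G) (F : 'I_M.+1 -> R) (lt_u : (c u < M.+1)%N) :
    \sum_(i < M.+1) (c u == i)%:R * F i = F (Ordinal lt_u).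
  rewrite (bigD1 (Ordinal lt_u)) //= eqxx mul1r big1 ?addr0 // => i.
  by rewrite -val_eqE eq_sym /= => /negPf->; rewrite mul0r.
(* [s] marks vertices in small levels, charged with all pairs through them; [g] marks the edges
   between two large levels. *)
pose s x : R := ((c x <= M)%N && ~~ big (c x))%:R.
pose g x z : R := (adj x z && good (c x) (c z))%:R.
have sum_s : \sum_x s x <= M.+1%:R * (sig * n).
  apply: le_trans (_ : \sum_x \sum_(i < M.+1) (c x == i)%:R * (~~ big i)%:R <= _).
    apply: ler_sum => x _; rewrite /s; case: leqP => /= [le_M|_].
      by rewrite -ltnS in le_M; rewrite (pick_level x (fun i => (~~ big i)%:R) le_M).
    by apply: sumr_ge0 => i _; rewrite mulr_ge0.
  rewrite exchange_big /= mulr_natl -[M.+1 in leRHS]card_ord -sumr_const.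
  apply: ler_sum => i _; rewrite -mulr_suml -cardSE.
  case: (boolP (big i)) => /= [_|]; first by rewrite mulr0 mulr_ge0.
  by rewrite /big -ltNge mulr1 => /ltW.
have sum_g : \sum_x \sum_z g x z <= del * n ^+ 2.
  apply: le_trans (_ : \sum_x \sum_z \sum_(i < M.+1) \sum_(j < M.+1)
    (c x == i)%:R * ((c z == j)%:R * (good i j && adj x z)%:R) <= _).
    apply: ler_sum => x _; apply: ler_sum => z _; rewrite /g andbC.
    case: (boolP (good (c x) (c z))) => /= [gd|_]; last first.
      by do 2!(apply: sumr_ge0 => ? _); rewrite !mulr_ge0.
    have lt_x : (c x < M.+1)%N by case/and3P: gd => le_M _ _; lia.
    have lt_z : (c z < M.+1)%N by case/and3P: gd => le_M _ _; lia.
    under eq_bigr => i _ do rewrite -mulr_sumr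
      (pick_level z (fun j => (good i j && adj x z)%:R) lt_z).
    by rewrite (pick_level x (fun i => (good i (c z) && adj x z)%:R) lt_x) /= gd.
  apply: le_trans (_ : \sum_(i < M.+1) \sum_(j < M.+1)
      del * (#|S i|%:R * #|S j|%:R) <= _).
    under eq_bigr => x _ do rewrite exchange_big /=.
    rewrite exchange_big /=; apply: ler_sum => i _.
    under eq_bigr => x _ do rewrite exchange_big /=.
    rewrite exchange_big /=; apply: ler_sum => j _.
    have := none; rewrite negb_exists => /forallP/(_ i).
    rewrite negb_exists => /forallP/(_ j); rewrite negb_and.
    case: (good i j) => /= [|_]; last first.
      rewrite big1 ?mulr_ge0 // => x _; rewrite big1 // => z _.
      by rewrite !mulr0.
    rewrite -ltNge => /ltW; apply: le_trans; rewrite edgesE natr_sum.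
    rewrite [leRHS]big_mkcond; apply: ler_sum => x _; rewrite inE.
    rewrite -mulr_sumr; case: eqP => _; last by rewrite mul0r.
    rewrite mul1r natr_sum [leRHS]big_mkcond; apply: ler_sum => z _.
    by rewrite inE; case: eqP => _; rewrite ?mul1r ?mul0r.
  under eq_bigr => i _ do rewrite -mulr_sumr -mulr_sumr.
  rewrite -mulr_sumr -mulr_suml ler_wpM2l // expr2.
  have le_n : \sum_(i < M.+1) #|S i|%:R <= n :> R.
    under eq_bigr => i _ do rewrite cardSE.
    rewrite exchange_big /= -[n]mulr1 -sum1; apply: ler_sum => x _.
    have [lt_M|le_M] := ltnP (c x) M.+1.
      under eq_bigr => i _ do rewrite -[_%:R]mulr1.
      by rewrite (pick_level x (fun=> 1) lt_M).
    by rewrite big1 // => i _; case: eqP => // eq_c; have := ltn_ord i; lia.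
  by rewrite ler_pM ?sumr_ge0.
(* An adjacent pair charged by neither [s] nor [g] has levels adding up to at least [M.+1]. *)
have low : M.+1%:R * (\sum_x \sum_z ((adj x z)%:R - (s x + s z + g x z))) <=
    \sum_x \sum_z (adj x z)%:R * ((c x)%:R + (c z)%:R) :> R.
  rewrite mulr_sumr; apply: ler_sum => x _; rewrite mulr_sumr; apply: ler_sum => z _.
  case: (boolP (adj x z)) => /= xz; last first.
    by rewrite mul0r sub0r mulrN oppr_le0 !mulr_ge0 ?addr_ge0.
  rewrite mul1r -natrD; have [le_M|gt_M] := leqP (c x + c z) M; last first.
    apply: le_trans (_ : M.+1%:R * 1 <= _); last by rewrite mulr1 ler_nat.
    by rewrite ler_wpM2l // gerBl !addr_ge0.
  suff : 1 <= s x + s z + g x z.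
    rewrite -subr_le0 => /(mulr_ge0_le0 (ler0n R M.+1)) le0.
    exact: le_trans le0 (ler0n _ _).
  rewrite /s /g /good xz le_M /=.
  have -> /= : (c x <= M)%N by lia.
  have -> /= : (c z <= M)%N by lia.
  by case: (big (c x)); case: (big (c z)) => /=; lra.
have sum_adj : n * lo <= \sum_(x : G) \sum_(z : G) (adj x z)%:R :> R.
  by rewrite -sum1; apply: ler_sum => x _; rewrite -degE; case/andP: (deg_c x).
have up : \sum_x \sum_z (adj x z)%:R * ((c x)%:R + (c z)%:R) <=
    2 * hi * (\sum_x c x)%:R :> R.
  have le_c : \sum_x \sum_z (adj x z)%:R * (c x)%:R <= hi * (\sum_x c x)%:R :> R.
    rewrite natr_sum mulr_sumr; apply: ler_sum => x _.
    by rewrite -mulr_suml -degE ler_wpM2r //; case/andP: (deg_c x).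
  have -> : \sum_x \sum_z (adj x z)%:R * ((c x)%:R + (c z)%:R) =
      \sum_x \sum_z (adj x z)%:R * (c x)%:R + \sum_z \sum_x (adj x z)%:R * (c z)%:R :> R.
    rewrite [X in _ + X]exchange_big -big_split /=; apply: eq_bigr => x _.
    by rewrite -big_split /=; apply: eq_bigr => z _; rewrite mulrDr.
  rewrite -mulrA mulrDl mul1r lerD //; apply: le_trans le_c; apply: ler_sum => x _.
  by apply: ler_sum => z _; rewrite adj_sym.
move: low; under eq_bigr => x _ do rewrite sumrB !big_split /= sum1.
rewrite sumrB !big_split /= -mulr_sumr sum1.
move: lt_hi up sum_s sum_g sum_adj le_sig; rewrite -/n.
move: (\sum_x \sum_z (adj x z)%:R * _) (\sum_x s x) (\sum_x \sum_z g x z).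
move: (\sum_(x : G) \sum_(z : G) (adj x z)%:R) (2 * hi * _) => e u w ss gg.
have : 0 < M.+1%:R :> R by rewrite ltr0n.
move: (M.+1%:R : R) => m m0 lt_u up sum_s sum_g sum_adj le_sig low.
have h1 : n * ss <= n * (m * (sig * n)) by rewrite ler_wpM2l.
have h2 : 2 * m * sig * n ^+ 2 <= del * n ^+ 2 by rewrite ler_wpM2r ?sqr_ge0.
have h3 : m * (n * lo - 2 * del * n ^+ 2) <= m * (e - (n * ss + n * ss + gg)).
  by rewrite ler_pM2l //; lra.
lra.
Qed.

(** * Almost uniform covers and their rounding *)

Definition cover_count (T : finType) (l : seq ({set T} * {set T})) (v : T) : nat :=
  (\sum_(p <- l) ((v \in p.1) + (v \in p.2)))%N.

Lemma cover_count_cons (T : finType) (p : {set T} * {set T}) l v :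
  cover_count (p :: l) v = ((v \in p.1) + (v \in p.2) + cover_count l v)%N.
Proof. by rewrite /cover_count big_cons. Qed.

Lemma sum_mem (R : pzSemiRingType) (T : finType) (A : {set T}) (F : T -> R) :
  \sum_v (v \in A)%:R * F v = \sum_(v in A) F v.
Proof.
rewrite [RHS]big_mkcond; apply: eq_bigr => v _.
by case: (v \in A); rewrite ?mul1r ?mul0r.
Qed.

Lemma sum_mem_nat (T : finType) (A : {set T}) : (\sum_v (v \in A) = #|A|)%N.
Proof.
by rewrite -sum1_card [RHS]big_mkcond; apply: eq_bigr => v _; case: (v \in A).
Qed.

(* The variance of the cover count grows by at most [2 (be + 1)] per unit of
   covered mass, because each new pair is chosen among the lightly covered vertices. *)
Lemma greedy_cover (R : realFieldType) (T : finType)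
    (P : {set T} -> {set T} -> Prop) (be : R) (rs : nat) :
  (0 < #|T|)%N ->
  (forall c : T -> nat, (\sum_v c v < rs * #|T|)%N ->
    exists A B : {set T}, [/\ P A B, #|A| = #|B|, (0 < #|A|)%N &
      (\sum_(v in A) c v + \sum_(v in B) c v)%:R <=
        2 * #|A|%:R * ((\sum_v c v)%:R / #|T|%:R + be)]) ->
  exists l : seq ({set T} * {set T}), [/\
    {in l, forall p, P p.1 p.2 /\ #|p.1| = #|p.2|},
    (rs * #|T| <= \sum_v cover_count l v <= (rs + 2) * #|T|)%N &
    (\sum_v cover_count l v ^ 2)%:R - (\sum_v cover_count l v)%:R ^+ 2 / #|T|%:R <=
      2 * (be + 1) * (\sum_v cover_count l v)%:R].
Proof.
move=> T0 step; set n : R := #|T|%:R in step *.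
have n0 : 0 < n by rewrite ltr0n.
(* Induction on the covered mass, to which each pair adds at least 2. The last pair adds at most
   [2 * #|T|], whence the bound [rs + 2]. *)
suff main k : exists l : seq ({set T} * {set T}), [/\
    {in l, forall p, P p.1 p.2 /\ #|p.1| = #|p.2|},
    (\sum_v cover_count l v <= (rs + 2) * #|T|)%N,
    (rs * #|T| <= \sum_v cover_count l v \/ k <= \sum_v cover_count l v)%N &
    (\sum_v cover_count l v ^ 2)%:R - (\sum_v cover_count l v)%:R ^+ 2 / n <=
      2 * (be + 1) * (\sum_v cover_count l v)%:R].
  have [l [Pl le_l ge_l var_l]] := main (rs * #|T|)%N.
  by exists l; split=> //; rewrite le_l andbT; case: ge_l.
elim: k => [|k [l [Pl le_l ge_l var_l]]].
  exists [::]; split=> //.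
  - by rewrite big1 // => v _; rewrite /cover_count big_nil.
  - by right.
  rewrite !big1 => [|v _|v _]; rewrite /cover_count ?big_nil //.
  by rewrite expr0n mul0r mulr0 subr0.
have [ge_rs|lt_rs] := leqP (rs * #|T|) (\sum_v cover_count l v).
  by exists l; split=> //; left.
have [A [B [PAB cAB A0 le_AB]]] := step _ lt_rs.
set c := cover_count l in le_l ge_l var_l lt_rs le_AB.
pose f v := ((v \in A) + (v \in B))%N.
have cE v : cover_count ((A, B) :: l) v = (f v + c v)%N by rewrite cover_count_cons.
have sum_f : (\sum_v f v = 2 * #|A|)%N.
  by rewrite big_split /= !sum_mem_nat -cAB mul2n addnn.
have sum_c : (\sum_v cover_count ((A, B) :: l) v = 2 * #|A| + \sum_v c v)%N.
  by under eq_bigr => v _ do rewrite cE; rewrite big_split /= sum_f.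
exists ((A, B) :: l); split.
- by move=> p; rewrite inE => /predU1P[->|/Pl].
- rewrite sum_c mulnDl addnC leq_add //; first exact: ltnW.
  by rewrite leq_mul2l max_card orbT.
- by right; rewrite sum_c; case: ge_l; lia.
rewrite sum_c; set S := (\sum_v c v)%N in var_l le_AB *.
have sq : (\sum_v cover_count ((A, B) :: l) v ^ 2 <=
    \sum_v c v ^ 2 + 2 * (\sum_(v in A) c v + \sum_(v in B) c v) + 4 * #|A|)%N.
  have -> : (4 * #|A| = \sum_v 2 * f v)%N by rewrite -big_distrr /= sum_f mulnA.
  have -> : (\sum_(v in A) c v + \sum_(v in B) c v = \sum_v f v * c v)%N.
    rewrite [X in (X + _)%N]big_mkcond [X in (_ + X)%N]big_mkcond -big_split /=.
    by apply: eq_bigr => v _; rewrite /f; case: (v \in A); case: (v \in B) => /=; lia.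
  rewrite big_distrr -!big_split /=; apply: leq_sum => v _; rewrite cE.
  have : (f v <= 2)%N by rewrite /f; case: (v \in A); case: (v \in B).
  by rewrite !expnS !expn0 !muln1; nia.
have {}sq : (\sum_v cover_count ((A, B) :: l) v ^ 2)%:R <= (\sum_v c v ^ 2)%:R +
    2 * (\sum_(v in A) c v + \sum_(v in B) c v)%:R + 4 * #|A|%:R :> R.
  by rewrite -!natrM -!natrD ler_nat.
have -> : (2 * #|A| + S)%:R = 2 * #|A|%:R + S%:R :> R by rewrite natrD natrM.
have m0 : 0 <= #|A|%:R :> R by [].
move: sq var_l le_AB m0; move: ((\sum_v c v ^ 2)%:R : R) (S%:R : R) (#|A|%:R : R).
move: ((\sum_(v in A) c v + \sum_(v in B) c v)%:R : R).
move: ((\sum_v cover_count ((A, B) :: l) v ^ 2)%:R : R) => q' w q s m sq var_l le_w m0.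
(* The term [4 * m * (s / n)] cancels the mean part of [le_w]; only [4 * m * (be + 1)] is left as
   growth of the variance. *)
have expand : (2 * m + s) ^+ 2 / n = s ^+ 2 / n + 4 * m * (s / n) + 4 * (m ^+ 2 / n).
  by rewrite !expr2; move: n n0 {step var_l le_w} => n n0; field; rewrite gt_eqF.
have : 0 <= m ^+ 2 / n by rewrite mulr_ge0 ?sqr_ge0 // invr_ge0 ltW.
rewrite expand; move: sq var_l le_w; move: (s / n) (s ^+ 2 / n) (m ^+ 2 / n).
by clear; move=> x y z; lra.
Qed.

(** Hall's theorem for [k i] slots per set: the weights [x] bound the slots of any family by the
    size of its union, since each vertex carries total load at most 1. *)
Lemma fractional_assignment (R : realFieldType) (I V : finType)
    (A : I -> {set V}) (x : V -> R) (k : I -> nat) :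
  (forall v, 0 <= x v) -> (forall v, x v * (\sum_i (v \in A i))%:R <= 1) ->
  (forall i, (k i)%:R <= \sum_(v in A i) x v) ->
  exists A' : I -> {set V}, [/\ forall i, A' i \subset A i,
    forall i, #|A' i| = k i & forall i j, i != j -> [disjoint A' i & A' j]].
Proof.
move=> x0 load cap; pose Q : finType := {i : I & 'I_(k i)}.
have [J|f f_inj fA] := @hall_sdr Q V (fun q => A (tag q)).
  set U := \bigcup_(q in J) _; pose K := [set tag q | q in J].
  have UE : U = \bigcup_(i in K) A i.
    apply/setP => v; apply/bigcupP/bigcupP => [[q qJ vA]|[_ /imsetP[q qJ ->] vA]].
      by exists (tag q); rewrite ?imset_f.
    by exists q.
  have le_J : (#|J| <= \sum_(i in K) k i)%N.
    apply: leq_trans (_ : \sum_(i in K) \sum_(j < k i) 1 <= _)%N; last first.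
      by apply: leq_sum => i _; rewrite sum_nat_const card_ord muln1.
    rewrite sig_big_dep -sum1_card /= big_mkcond [leqRHS]big_mkcond; apply: leq_sum => q _.
    by case: ifP => // qJ; rewrite andbT imset_f.
  rewrite -(ler_nat R); apply: le_trans (_ : (\sum_(i in K) k i)%:R <= _).
    by rewrite ler_nat.
  rewrite natr_sum; apply: le_trans (_ : \sum_(i in K) \sum_(v in A i) x v <= _).
    exact: ler_sum.
  under eq_bigr => i _ do rewrite -sum_mem.
  rewrite exchange_big /= -sum1_card natr_sum [leRHS]big_mkcond; apply: ler_sum => v _.
  rewrite -mulr_suml; case: ifP => vU; last first.
    rewrite big1 ?mul0r // => i iK; case: (boolP (v \in A i)) => // vA.
    by move/negP: vU; case; rewrite UE; apply/bigcupP; exists i.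
  apply: le_trans (load v); rewrite mulrC ler_wpM2l // -natr_sum ler_nat.
  by rewrite [leqRHS](bigID [in K]) leq_addr.
pose A' i := [set f (Tagged (fun i => 'I_(k i)) j) | j in 'I_(k i)].
exists A'; split=> [i|i|i j neq_ij].
- by apply/subsetP => _ /imsetP[j _ ->]; apply: fA.
- rewrite card_imset ?card_ord // => j1 j2 /f_inj eq_j.
  by apply/eqP; have /eqP := eq_j; rewrite -tag_eqE /tag_eq eqxx tagged_asE.
rewrite -setI_eq0; apply/eqP/setP => v; rewrite !inE; apply/negP => /andP[].
case/imsetP=> i1 _ -> /imsetP[j1 _ /f_inj/(congr1 (@tag _ _)) /= eq_ij].
by rewrite eq_ij eqxx in neq_ij.
Qed.

(** For [u >= r] the left side is [z = u / r - 1], and [4 * b * z <= (z + b) ^ 2]. The square makes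
    the excess accessible to a variance bound. *)
Lemma excess_le_sq (R : realFieldType) (b r u : R) : 0 < b -> 0 < r -> 0 <= u ->
  u * (r^-1 - (Num.max r u)^-1) <= (u / r - 1 + b) ^+ 2 / (4 * b).
Proof.
move=> b0 r0 u0; rewrite maxEle; case: ifP => [le_ru|_]; last first.
  by rewrite subrr mulr0 divr_ge0 ?sqr_ge0 // mulr_ge0 // ltW.
have u_gt0 : 0 < u by apply: lt_le_trans le_ru.
rewrite mulrBr mulfV ?gt_eqF // ler_pdivlMr ?mulr_gt0 //.
set z := u / r - 1; have := sqr_ge0 (z - b); lra.
Qed.

(** Uniform weight [1 / r], with [r] the mean of [c], would have total exactly [#|V|]. Capping it at
    [1 / c v] keeps the loads at most 1, and the variance bounds the resulting loss. *)
Lemma balanced_subpairs (R : archiRealFieldType) (I V : finType)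
    (A B : I -> {set V}) (b : R) :
  let c v := (\sum_i ((v \in A i) + (v \in B i)))%N in
  (forall i, #|A i| = #|B i|) -> 0 < b -> (0 < #|V|)%N -> (0 < \sum_v c v)%N ->
  (\sum_v c v ^ 2)%:R - (\sum_v c v)%:R ^+ 2 / #|V|%:R <=
    b ^+ 2 * ((\sum_v c v)%:R ^+ 2 / #|V|%:R) ->
  exists A' B' : I -> {set V}, [/\ forall i, A' i \subset A i /\ B' i \subset B i,
    forall i, #|A' i| = #|B' i|, forall i, [disjoint A' i & B' i],
    forall i j, i != j -> [disjoint A' i :|: B' i & A' j :|: B' j] &
    #|V|%:R * (1 - b) <= (\sum_i 2 * (#|A' i| + 1))%:R].
Proof.
move=> c cAB b0 V0 S0 var_c; set n : R := #|V|%:R in var_c *.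
set S : R := (\sum_v c v)%:R in var_c.
have n0 : 0 < n by rewrite ltr0n.
have S_gt0 : 0 < S by rewrite ltr0n.
pose r := S / n; have r0 : 0 < r by rewrite divr_gt0.
pose x v : R := (Num.max r (c v)%:R)^-1.
have max_gt0 v : 0 < Num.max r (c v)%:R by rewrite lt_max r0.
have x0 v : 0 <= x v by rewrite invr_ge0 ltW.
pose loss v := r^-1 - x v.
have loss0 v : 0 <= loss v by rewrite subr_ge0 lef_pV2 ?posrE // le_max lexx.
pose AB (q : I * bool) := if q.2 then B q.1 else A q.1.
have sum_pair (F : I * bool -> nat) :
    (\sum_q F q = \sum_i (F (i, true) + F (i, false)))%N.
  rewrite (eq_bigr (fun q => F (q.1, q.2))) => [|[]//].
  rewrite -(pair_bigA _ (fun i s => F (i, s))) /=.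
  by apply: eq_bigr => i _; rewrite big_bool.
have cE v : (\sum_q (v \in AB q) = c v)%N.
  by rewrite sum_pair; apply: eq_bigr => i _; rewrite addnC.
pose XA i := \sum_(v in A i) x v; pose XB i := \sum_(v in B i) x v.
(* Rounding down the lighter side and using that number on both sides makes the subpair balanced. *)
pose k i := minn (Num.truncn (XA i)) (Num.truncn (XB i)).
have XA0 i : 0 <= XA i by apply: sumr_ge0.
have XB0 i : 0 <= XB i by apply: sumr_ge0.
have [||A' [sA' cA' dA']] := @fractional_assignment R _ V AB x (fun q => k q.1) x0.
- move=> v; rewrite cE /x mulrC ler_pdivrMr // mul1r le_max lexx orbT //.
- case=> i [] /=; rewrite /AB /=.
    by apply: le_trans (_ : (Num.truncn (XB i))%:R <= _);
      rewrite ?truncn_le // ler_nat geq_minr.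
  by apply: le_trans (_ : (Num.truncn (XA i))%:R <= _);
    rewrite ?truncn_le // ler_nat geq_minl.
exists (fun i => A' (i, false)), (fun i => A' (i, true)); split.
- by move=> i; split; [apply: (sA' (i, false))|apply: (sA' (i, true))].
- by move=> i; rewrite !cA'.
- by move=> i; apply: dA'; rewrite xpair_eqE eqxx.
- move=> i j neq_ij; rewrite -setI_eq0 setIUl !setIUr !setU_eq0 !setI_eq0.
  by rewrite !dA' // xpair_eqE (negPf neq_ij).
have sumV (F : V -> R) :
    \sum_i (\sum_(v in A i) F v + \sum_(v in B i) F v) = \sum_v (c v)%:R * F v.
  under eq_bigr => i _ do rewrite -!sum_mem -big_split /=.
  rewrite exchange_big /=; apply: eq_bigr => v _.
  by rewrite natr_sum mulr_suml; apply: eq_bigr => i _; rewrite natrD mulrDl.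
(* As [#|A i| = #|B i|], the lighter side misses at most the losses of both sides together; rounding
   costs less than one more vertex. *)
have le_k i : 2 * (#|A i|%:R / r) - 2 * (\sum_(v in A i) loss v + \sum_(v in B i) loss v)
    <= (2 * (#|A' (i, false)| + 1))%:R.
  have lossA (C : {set V}) : \sum_(v in C) loss v = #|C|%:R / r - \sum_(v in C) x v.
    by rewrite sumrB sumr_const mulr_natl.
  have sumA0 (C : {set V}) : 0 <= \sum_(v in C) loss v by apply: sumr_ge0.
  rewrite cA' /= natrM -mulrBr ler_wpM2l // addn1 /k /minn.
  have := sumA0 (A i); have := sumA0 (B i); rewrite !lossA -/(XA i) -/(XB i) -cAB.
  have := truncnS_gt (XA i); have := truncnS_gt (XB i).
  by case: ifP => _; lra.
rewrite natr_sum; apply: le_trans (ler_sum _ (fun i _ => le_k i)).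
rewrite sumrB -!mulr_sumr sumV -mulr_suml.
have SE : 2 * \sum_i #|A i|%:R = S.
  rewrite /S natr_sum -[RHS](eq_bigr _ (fun v _ => mulr1 _)) -sumV mulr_sumr.
  apply: eq_bigr => i _; rewrite !sumr_const cAB; lra.
rewrite mulrA SE.
have -> : S / r = n by rewrite /r; field; rewrite !gt_eqF.
(* The deviations [c v / r - 1] have mean 0 and mean square at most [b ^ 2]; adding [b] gives mean
   square at most [2 * b ^ 2], then divided by [4 * b]. *)
have excess : \sum_v (c v)%:R * loss v <= b / 2 * n.
  apply: le_trans (ler_sum _ (fun v _ => excess_le_sq b0 r0 (ler0n R (c v)))) _.
  rewrite -mulr_suml ler_pdivrMr ?mulr_gt0 //.
  have -> : \sum_v ((c v)%:R / r - 1 + b) ^+ 2 =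
      (\sum_v c v ^ 2)%:R / r ^+ 2 + 2 * (b - 1) * (S / r) + (b - 1) ^+ 2 * n.
    rewrite /S !natr_sum !mulr_suml mulr_sumr.
    have -> : (b - 1) ^+ 2 * n = \sum_(v : V) (b - 1) ^+ 2 by rewrite sumr_const mulr_natr.
    rewrite -!big_split /=; apply: eq_bigr => v _.
    by rewrite natrX; move: r0 => /gt_eqF/negbT; clear; move=> r0; field.
  have -> : S / r = n by rewrite /r; field; rewrite !gt_eqF.
  have rE : S ^+ 2 / n = r ^+ 2 * n by rewrite /r; field; rewrite gt_eqF.
  have : (\sum_v c v ^ 2)%:R / r ^+ 2 <= (1 + b ^+ 2) * n.
    by rewrite ler_pdivrMr ?exprn_gt0 //; move: var_c; rewrite rE; lra.
  by rewrite !expr2; lra.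
by lra.
Qed.

(** * Tiling almost all of the graph *)

Lemma tileable_bigcup (G H : sgraph) (I : finType) (X : I -> {set G}) (k : I -> nat) :
  (forall i, tileable H (X i) (k i)) -> (forall i j, i != j -> [disjoint X i & X j]) ->
  tileable H (\bigcup_i X i) (\sum_i k i).
Proof.
move=> tX dX; suff main (s : seq I) : uniq s ->
    tileable H (\bigcup_(i <- s) X i) (\sum_(i <- s) k i).
  exact/main/index_enum_uniq.
elim: s => [|i s IHs] /=; first by rewrite !big_nil => _; apply: tileable_none; rewrite cards0.
case/andP=> i_s uniq_s; rewrite !big_cons; apply: tileableU (IHs uniq_s) _ => //.
rewrite bigcup_seq -setI_eq0; apply/eqP/setP => z; rewrite !inE.
apply/negP => /andP[zi /bigcupP[j js zj]].
have /dX/pred0P/(_ z) : i != j by apply: contraNneq i_s => ->.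
by rewrite /= zi zj.
Qed.

Lemma card_bigcup_disjoint (I T : finType) (X : I -> {set T}) :
  (forall i j, i != j -> [disjoint X i & X j]) ->
  #|\bigcup_i X i| = (\sum_i #|X i|)%N.
Proof.
move=> dX; under [RHS]eq_bigr => i _ do rewrite -sum_mem_nat.
rewrite exchange_big -sum_mem_nat; apply: eq_bigr => v _ /=.
case: (boolP (v \in _)) => [/bigcupP[i _ vi]|vU]; last first.
  rewrite big1 // => i _; case: (boolP (v \in X i)) => // vi.
  by case/bigcupP: vU; exists i.
rewrite (bigD1 i) //= vi big1 // => j; rewrite eq_sym => /dX/pred0P/(_ v) /=.
by rewrite vi /= => ->.
Qed.

(** Supplies the step of [greedy_cover]. On subsets of two levels [i] and [j] the count [c] is
    constant, so [i + j <= M] bounds the two sums however the pair shrinks. *)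
Lemma light_lower_regular_pair (R : archiRealFieldType) (G : sgraph)
    (lo hi del sig be : R) (rs L K : nat) (c : G -> nat) :
  (0 < #|G|)%N -> (forall x : G, lo <= (degree x)%:R <= hi) ->
  0 < del -> 0 < sig -> 0 <= be -> (4 <= L)%N -> 2 * L%:R ^+ 2 <= K%:R * del ->
  2 * (2 * rs%:R + 2 * be + 1) * sig <= del ->
  0 < lo - 2 * del * #|G|%:R ->
  (hi - lo + 2 * del * #|G|%:R) * rs%:R <= be * (lo - 2 * del * #|G|%:R) ->
  (\sum_v c v < rs * #|G|)%N ->
  exists A B : {set G}, [/\ sig * #|G|%:R <= (L ^ K * #|A|)%:R /\
      lower_regular (del / 3) (#|A| %/ L).+1 A B,
    #|A| = #|B|, (0 < #|A|)%N &
    (\sum_(v in A) c v + \sum_(v in B) c v)%:R <=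
      2 * #|A|%:R * ((\sum_v c v)%:R / #|G|%:R + be)].
Proof.
move=> G0 deg_c del0 sig0 be0 L4 leK le_sig lo0 le_hi ltS.
set n : R := #|G|%:R in lo0 le_hi *; set S : R := (\sum_v c v)%:R.
have n0 : 0 < n by rewrite ltr0n.
have S0 : 0 <= S by [].
have ltSn : S < rs%:R * n by rewrite -natrM ltr_nat.
have r0 : 0 <= S / n by rewrite divr_ge0 // ltW.
have r_lt : S / n < rs%:R by rewrite ltr_pdivrMr.
have th0 : 0 <= 2 * (S / n + be) by rewrite mulr_ge0 ?addr_ge0.
pose M := Num.truncn (2 * (S / n + be)).
have M_le : M%:R <= 2 * (S / n + be) by rewrite truncn_le.
have M_gt : 2 * (S / n + be) < M.+1%:R by apply: truncnS_gt.
have MS : M.+1%:R = M%:R + 1 :> R by rewrite -natr1.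
have [||i [j [le_ij big_i big_j dense]]] :=
  @dense_light_levels R G c M lo hi del sig deg_c (ltW del0) (ltW sig0).
- apply: le_trans le_sig; apply: ler_wpM2r; first exact: ltW.
  by apply: ler_wpM2l => //; rewrite MS; lra.
- rewrite -/n -/S; apply: le_lt_trans (_ : 2 * (S / n + be) * n * (lo - 2 * del * n) < _).
    have -> : 2 * (S / n + be) * n = 2 * (S + be * n) by field; rewrite gt_eqF.
    have h1 : (hi - lo + 2 * del * n) * S <= be * (lo - 2 * del * n) * n.
      have [h_ge0|/ltW h_le0] := lerP 0 (hi - lo + 2 * del * n).
        apply: le_trans (_ : (hi - lo + 2 * del * n) * (rs%:R * n) <= _).
          by rewrite ler_wpM2l // ltW.
        by rewrite mulrA ler_wpM2r // ltW.
      apply: (@le_trans _ _ 0); first by rewrite mulr_le0_ge0.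
      by rewrite !mulr_ge0 // ltW.
    by lra.
  by rewrite ltr_pM2r // ltr_pM2r.
set Si := [set x | c x == i] in big_i dense; set Sj := [set x | c x == j] in big_j dense.
have [X [Y [sX sY cX cY le_e]]] := dense_square (geq_minl #|Si| #|Sj|) (geq_minr _ _).
set q := minn _ _ in cX cY le_e.
have big_q : sig * n <= q%:R by rewrite /q /minn; case: ifP.
have q0 : (0 < q)%N by rewrite -(ltr0n R); apply: lt_le_trans big_q; rewrite mulr_gt0.
have dense_XY : del * q%:R ^+ 2 <= (edges X Y)%:R.
  have SS0 : 0 < #|Si|%:R * #|Sj|%:R :> R.
    by rewrite mulr_gt0 //; [apply: lt_le_trans big_i|apply: lt_le_trans big_j];
      rewrite mulr_gt0.
  rewrite -(ler_pM2l SS0).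
  have {}le_e : q%:R ^+ 2 * (edges Si Sj)%:R <= #|Si|%:R * #|Sj|%:R * (edges X Y)%:R :> R.
    by rewrite -natrX -!natrM ler_nat.
  apply: le_trans le_e; rewrite mulrA [_ * del]mulrC [leLHS]mulrC.
  by rewrite ler_wpM2l ?sqr_ge0.
have [m [A [B [[sA sB] [cA cB] m0 le_m reg]]]] :=
  lower_regular_pair cX cY q0 L4 del0 dense_XY leK.
exists A, B; rewrite cA cB; split=> //.
  by split=> //; apply: le_trans big_q _; rewrite ler_nat.
have sum_level (C : {set G}) k : C \subset [set x | c x == k] -> #|C| = m ->
    (\sum_(v in C) c v = m * k)%N.
  move=> sC cC; rewrite (eq_bigr (fun=> k)) ?sum_nat_const ?cC // => v vC.
  by have := subsetP sC v vC; rewrite inE => /eqP.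
rewrite (sum_level A i) ?(sum_level B j) //.
- rewrite -mulnDr natrM [2 * _]mulrC -mulrA ler_wpM2l //.
  by apply: le_trans M_le; rewrite ler_nat.
- exact: subset_trans sB sY.
- exact: subset_trans sA sX.
Qed.

(** The leftover has three sources: the rounding of the cover, the [#|A| / L] untiled vertices on
    each side of a pair, and a constant loss per pair. *)
Lemma bipartite_tiling (R : archiRealFieldType) (G H : sgraph)
    (lo hi del sig be b : R) (rs L K D : nat) :
  (0 < #|G|)%N -> (forall x : G, lo <= (degree x)%:R <= hi) ->
  bipartite H -> (forall x : H, (degree x <= D)%N) -> (0 < D)%N -> (0 < #|H|)%N ->
  0 < del -> 0 < sig -> 0 <= be -> 0 < b -> (4 <= L)%N -> (0 < rs)%N ->
  2 * L%:R ^+ 2 <= K%:R * del ->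
  2 * (2 * rs%:R + 2 * be + 1) * sig <= del ->
  0 < lo - 2 * del * #|G|%:R ->
  (hi - lo + 2 * del * #|G|%:R) * rs%:R <= be * (lo - 2 * del * #|G|%:R) ->
  2 * (be + 1) <= b ^+ 2 * rs%:R ->
  (8 * D * #|H|)%:R * L%:R ^+ K.+1 <= (del / 3) ^+ D * (sig * #|G|%:R) ->
  exists2 k, tileable H [set: G] k &
    k%:R <= b * #|G|%:R + (rs + 2)%:R * #|G|%:R / L%:R +
      (2 + #|H|)%:R * (rs + 2)%:R * L%:R ^+ K / sig.
Proof.
move=> G0 deg_c bipH degD D0 h0 del0 sig0 be0 b0 L4 rs0 leK le_sig lo0 le_hi le_b le_h.
set n : R := #|G|%:R in lo0 le_hi le_h *.
have n0 : 0 < n by rewrite ltr0n.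
have L_gt0 : (0 < L)%N by apply: leq_trans L4.
have L0 : 0 < L%:R :> R by rewrite ltr0n.
pose P (A B : {set G}) := sig * n <= (L ^ K * #|A|)%:R /\
  lower_regular (del / 3) (#|A| %/ L).+1 A B.
have [l [Pl /andP[geS leS] var_l]] := @greedy_cover R G P be rs G0
  (fun c => light_lower_regular_pair G0 deg_c del0 sig0 be0 L4 leK le_sig lo0 le_hi).
pose A (i : 'I_(size l)) := (tnth (in_tuple l) i).1.
pose B (i : 'I_(size l)) := (tnth (in_tuple l) i).2.
pose c v := (\sum_i ((v \in A i) + (v \in B i)))%N.
have PAB i : P (A i) (B i) /\ #|A i| = #|B i| by apply: Pl; apply: mem_tnth.
have cE v : cover_count l v = c v by rewrite /cover_count big_tnth.
have sum_c : (\sum_v cover_count l v = \sum_v c v)%N by apply: eq_bigr => v _.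
have sum_c2 : (\sum_v cover_count l v ^ 2 = \sum_v c v ^ 2)%N.
  by apply: eq_bigr => v _; rewrite cE.
move: geS leS var_l; rewrite sum_c sum_c2.
rewrite -!(ler_nat R) !natrM -/n; set S : R := (\sum_v c v)%:R => geS leS var_c.
have S0 : (0 < \sum_v c v)%N.
  by rewrite -(ltr0n R); apply: lt_le_trans geS; rewrite mulr_gt0 ?ltr0n.
have S_gt0 : 0 < S by rewrite ltr0n.
have [|A' [B' [sAB' cAB' dAB' dI le_cov]]] :=
  @balanced_subpairs R _ G A B b (fun i => (PAB i).2) b0 G0 S0.
  apply: le_trans var_c _; rewrite -/S -/n -/c.
  apply: le_trans (_ : b ^+ 2 * rs%:R * S <= _); first by rewrite ler_wpM2r // ltW.
  rewrite -mulrA ler_wpM2l ?sqr_ge0 // expr2 mulrAC; apply: ler_wpM2r; first exact: ltW.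
  by rewrite ler_pdivlMr.
pose X i := A' i :|: B' i.
pose N i := (#|A i| %/ L).+1.
have tX i : tileable H (X i) (2 * (N i + #|H|)).
  have [[big_A reg] _] := PAB i; have [sA sB] := sAB' i.
  apply: tile_pair bipH degD D0 h0 _ _ reg sA sB (dAB' i) (cAB' i).
    by rewrite divr_ge0 // ltW.
  have LK0 : 0 < L%:R ^+ K.+1 :> R by rewrite exprn_gt0.
  rewrite -(ler_pM2r LK0); apply: le_trans le_h _; rewrite -mulrA ler_wpM2l //.
    by rewrite exprn_ge0 // divr_ge0 // ltW.
  apply: le_trans big_A _; rewrite -natrX -natrM ler_nat expnS mulnA mulnC leq_mul2r.
  by rewrite ltnW ?orbT // ltn_ceil.
have cardX i : #|X i| = (2 * #|A' i|)%N.
  by apply/eqP; rewrite mul2n -addnn {2}cAB'; have [_ ->] := leq_card_setU (A' i) (B' i).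
have tU := tileable_bigcup tX dI; set U := \bigcup_i _ in tU.
have cardU : #|U| = (\sum_i 2 * #|A' i|)%N.
  by rewrite card_bigcup_disjoint //; apply: eq_bigr => i _; apply: cardX.
have tC : tileable H (~: U) (#|G| - #|U|) by apply: tileable_none; rewrite cardsCs setCK.
have dUC : [disjoint U & ~: U] by rewrite -setI_eq0 setICr.
exists (\sum_i 2 * (N i + #|H|) + (#|G| - #|U|))%N.
  by have := tileableU tU tC dUC; rewrite setUCr.
have le_U : (#|U| <= #|G|)%N by apply: max_card.
rewrite natrD natrB // cardU.
have SE : S = \sum_i 2 * #|A i|%:R.
  rewrite /S /c exchange_big natr_sum; apply: eq_bigr => i _.
  by rewrite big_split /= !sum_mem_nat -(PAB i).2 addnn -mul2n natrM.
have sum_l (u : R) : \sum_(i < size l) u = (size l)%:R * u.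
  by rewrite sumr_const card_ord mulr_natl.
have NE : (\sum_i 2 * (N i + #|H|))%:R <= S / L%:R + (size l)%:R * (2 + 2 * #|H|%:R) :> R.
  rewrite SE natr_sum mulr_suml -sum_l.
  rewrite -big_split /=; apply: ler_sum => i _.
  have : (#|A i| %/ L)%:R <= #|A i|%:R / L%:R :> R.
    by rewrite ler_pdivlMr // -natrM ler_nat leq_trunc_div.
  have -> : (2 * (N i + #|H|))%:R = 2 * ((#|A i| %/ L)%:R + 1 + #|H|%:R) :> R.
    by rewrite natr1 natrM natrD.
  by lra.
move: le_cov; under eq_bigr => i _ do rewrite mulnDr.
rewrite big_split /= sum_nat_const card_ord natrD => le_cov.
(* Each pair carries mass at least [2 * sig * n / L ^ K], and the total mass is at most
   [(rs + 2) * n]. *)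
have le_l : 2 * (size l)%:R <= (rs + 2)%:R * L%:R ^+ K / sig.
  rewrite ler_pdivlMr // -(ler_pM2r n0) -mulrA [leRHS]mulrAC.
  apply: le_trans (_ : S * L%:R ^+ K <= _); last by rewrite ler_wpM2r ?exprn_ge0.
  rewrite SE [2 * _]mulrC -mulrA -sum_l mulr_suml; apply: ler_sum => i _.
  rewrite -mulrA ler_wpM2l //; have [[+ _] _] := PAB i.
  by rewrite natrM natrX [_ ^+ K * _]mulrC.
have le_SL : S / L%:R <= (rs + 2)%:R * n / L%:R.
  by apply: ler_wpM2r leS; rewrite invr_ge0 ltW.
have le_lh := ler_wpM2r (ler0n R (2 + #|H|)) le_l.
have -> : (2 + #|H|)%:R * (rs + 2)%:R * L%:R ^+ K / sig =
    (rs + 2)%:R * L%:R ^+ K / sig * (2 + #|H|)%:R by rewrite [RHS]mulrC !mulrA.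
move: le_cov NE le_SL le_lh; rewrite -/n (natrD _ 2) muln1.
move: ((rs + 2)%:R * n / L%:R) ((rs + 2)%:R * L%:R ^+ K / sig) (S / L%:R).
move: (\sum_i 2 * (N i + #|H|))%N (\sum_i 2 * #|A' i|)%N => t q u v w.
by clear; rewrite mulr2n; lra.
Qed.

(** * Choice of the parameters *)

Lemma sq_bound (R : realFieldType) (a : R) :
  0 < a -> a <= 7 / 20 -> a ^+ 2 <= 1 / 8.
Proof.
move=> a0 a_le.
have : a * a <= 7 / 20 * (7 / 20) by rewrite ler_pM // ltW.
by rewrite expr2; lra.
Qed.

(** There are about [2 * rs] light levels, with [rs] of order [a ^ (-2)]; this cutoff for small
    levels keeps the edges meeting them within the [a ^+ 3] budget. *)
Lemma level_bound (R : realFieldType) (a rs : R) : 0 < a -> a <= 7 / 20 ->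
  1 <= a ^+ 2 * rs -> a ^+ 2 * rs <= 1 + a ^+ 2 ->
  2 * (2 * rs + 2 * (a ^+ 2 * rs) + 1) * (a ^+ 5 / 6) <= a ^+ 3.
Proof.
move=> a0 a_le y1 y2; have s0 : 0 <= a ^+ 2 by rewrite sqr_ge0.
have s1 := sq_bound a0 a_le.
have -> : 2 * (2 * rs + 2 * (a ^+ 2 * rs) + 1) * (a ^+ 5 / 6) =
  a ^+ 3 * ((4 * (a ^+ 2 * rs) + 4 * (a ^+ 2 * rs) * a ^+ 2 + 2 * a ^+ 2) / 6).
  by field.
rewrite ger_pMr ?exprn_gt0 //.
move: y1 y2; move: (a ^+ 2 * rs) => y y1 y2.
move: (a ^+ 2) y2 s0 s1 => s y2 s0 s1.
have : y * s <= (1 + s) * (1 / 8) by apply: ler_pM => //; lra.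
by lra.
Qed.

(** Irregular degrees and discarded edges cost only a multiple of [a ^+ 2 * rho], so a slack of
    [a ^+ 2 * rs] above the mean level suffices. *)
Lemma light_bound (R : realFieldType) (a rho dn rs : R) :
  0 < a -> a <= 7 / 20 -> 0 < rho -> 0 <= dn -> 3 * dn <= a ^+ 2 * rho ->
  0 <= rs ->
  0 < (1 - a ^+ 12 / 10) * rho - 2 * dn /\
  ((1 + a ^+ 12 / 10) * rho - (1 - a ^+ 12 / 10) * rho + 2 * dn) * rs <=
    a ^+ 2 * rs * ((1 - a ^+ 12 / 10) * rho - 2 * dn).
Proof.
move=> a0 a_le rho0 dn0 le_dn rs0; have s0 : 0 <= a ^+ 2 by rewrite sqr_ge0.
have s1 := sq_bound a0 a_le.
have t1 : a ^+ 12 <= a ^+ 2 / 10.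
  have -> : a ^+ 12 = a ^+ 2 * (a ^+ 2 * a ^+ 2 * (a ^+ 2) ^+ 3) by ring.
  rewrite ler_wpM2l //; have le1 : (a ^+ 2) ^+ 3 <= 1 by apply: exprn_ile1 => //; apply: le_trans s1 _; lra.
  have le2 : a ^+ 2 * a ^+ 2 <= 1 / 8 * (1 / 8) by apply: ler_pM.
  have : a ^+ 2 * a ^+ 2 * (a ^+ 2) ^+ 3 <= 1 / 8 * (1 / 8) * 1.
    by apply: ler_pM => //; [rewrite mulr_ge0|apply: exprn_ge0].
  by lra.
have t0 : 0 <= a ^+ 12 by rewrite exprn_ge0 // ltW.
move: s0 s1 t0 t1 le_dn; move: (a ^+ 2) (a ^+ 12) => s t s0 s1 t0 t1 le_dn.
have tr : t * rho <= s * rho / 10 by rewrite mulrAC ler_pM2r.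
have sr : s * rho <= 1 / 8 * rho by rewrite ler_pM2r.
have sdn : s * dn <= 1 / 8 * dn by rewrite ler_wpM2r.
have tr0 : 0 <= t * rho by rewrite mulr_ge0 // ltW.
have str : s * (t * rho) <= 1 / 8 * (t * rho) by rewrite ler_wpM2r.
split; first by lra.
rewrite [s * rs]mulrC -[leRHS]mulrA mulrC ler_wpM2l //; lra.
Qed.

Lemma size_bounds (R : realFieldType) (d L K : R) :
  0 < d -> 3 * d <= 1 -> 2 / d < L -> L <= 2 / d + 1 ->
  2 * L ^+ 2 / d < K -> K <= 2 * L ^+ 2 / d + 1 ->
  [/\ 4 <= L, 2 * L ^+ 2 <= K * d, L * d ^+ 2 <= 1 & (2 * K + 6) * d ^+ 3 <= 101].
Proof.
move=> d0 d1 L1 L2 K1 K2.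
have dL1 : 2 < L * d by rewrite -ltr_pdivrMr.
have dL2 : L * d <= 2 + d.
  by rewrite -ler_pdivlMr // mulrDl divff ?gt_eqF // mulrC.
have dd : d * d <= 1 / 3 * d by rewrite ler_pM2r //; lra.
have L0 : 0 < L by apply: lt_trans L1; rewrite divr_gt0.
have LL : (L * d) * (L * d) <= (2 + d) * (2 + d) by apply: ler_pM => //; nra.
have ddd : d * (d * d) <= 1 / 27 by nra.
split.
- by nra.
- by apply: ltW; rewrite -ltr_pdivrMr.
- by rewrite expr2; nra.
have K3 : K * d <= 2 * L ^+ 2 + d.
  by rewrite -ler_pdivlMr // mulrDl divff ?gt_eqF.
have : K * d * (d * d) <= (2 * L ^+ 2 + d) * (d * d) by rewrite ler_wpM2r // mulr_ge0 ?ltW.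
by rewrite !exprS expr0 !mulr1; nra.
Qed.

(** As [L] is at most [(a ^+ 3) ^- 2], the factor [Q] absorbs [L ^+ K.+1] and still leaves
    [(a ^+ 3) ^+ 4], which pays for the polynomial factors in [a]. *)
Lemma order_bounds (R : realFieldType) (a e Q h n L rs : R) (D K : nat) :
  0 < a -> a <= 7 / 20 -> 0 <= e -> e <= 1 -> (0 < D)%N -> 1 <= h -> 0 < n ->
  0 < L -> L * (a ^+ 3) ^+ 2 <= 1 -> 0 <= Q -> Q <= (a ^+ 3) ^+ (2 * K + 6) ->
  0 <= rs -> a ^+ 2 * rs <= 1 + a ^+ 2 ->
  h <= e / (16 * D%:R) * ((a ^+ 3) ^+ D * Q) * 3 ^- D * n ->
  8 * D%:R * h * L ^+ K.+1 <= (a ^+ 3 / 3) ^+ D * (a ^+ 5 / 6 * n) /\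
  (2 + h) * (rs + 2) * L ^+ K / (a ^+ 5 / 6) <= a * n.
Proof.
move=> a0 a_le e0 e1 D0 h1 n0 L0 Ld Q0 leQ rs0 le_rs le_h.
have D1 : 1 <= D%:R :> R by rewrite ler1n.
have D_gt0 : 0 < D%:R :> R by rewrite ltr0n.
have s0 : 0 < a ^+ 2 by rewrite exprn_gt0.
have s1 := sq_bound a0 a_le.
have [d dE] : exists d, d = a ^+ 3 by exists (a ^+ 3).
rewrite -dE in Ld leQ le_h *; have d0 : 0 < d by rewrite dE exprn_gt0.
have d1 : d <= 1 by rewrite dE exprn_ile1 ?ltW //; lra.
pose w := (d / 3) ^+ D.
have w0 : 0 <= w by rewrite exprn_ge0 // divr_ge0 // ltW.
have w1 : w <= 1 by rewrite exprn_ile1 ?divr_ge0 ?(ltW d0) //; lra.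
have wn0 : 0 <= w * n by rewrite mulr_ge0 // ltW.
have QL k : (k <= K.+1)%N -> Q * L ^+ k <= d ^+ 4.
  move=> le_k; apply: le_trans (_ : d ^+ (2 * K + 6) * L ^+ k <= _).
    by rewrite ler_wpM2r // exprn_ge0 // ltW.
  have [m ->] : exists m, (2 * K + 6 = 4 + (2 * k + m))%N.
    by exists (2 * K + 2 - 2 * k)%N; move: le_k; clear; lia.
  have -> : d ^+ (4 + (2 * k + m)) * L ^+ k = d ^+ 4 * ((L * d ^+ 2) ^+ k * d ^+ m).
    rewrite [d ^+ (4 + _)]exprD exprD exprMn -exprM -!mulrA; congr (_ * _).
    by rewrite [_ * (d ^+ m * _)]mulrA [_ * L ^+ k]mulrC.
  rewrite ger_pMr ?exprn_gt0 //.
  apply: mulr_ile1; rewrite ?exprn_ge0 ?(ltW d0) ?mulr_ge0 ?exprn_ge0 ?(ltW d0) ?(ltW L0) //.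
    by rewrite exprn_ile1 ?mulr_ge0 ?exprn_ge0 ?(ltW d0) ?(ltW L0).
  by rewrite exprn_ile1 ?(ltW d0).
have Dh : D%:R * h <= w * n * Q / 16.
  have -> : w * n * Q / 16 = D%:R * (1 / (16 * D%:R) * (d ^+ D * Q) * 3 ^- D * n).
    by rewrite /w exprMn exprVn; field; rewrite !gt_eqF ?exprn_gt0 ?ltr0n.
  rewrite ler_pM2l //; apply: le_trans le_h _.
  rewrite ler_pM2r // ler_pM2r ?invr_gt0 ?exprn_gt0 // ler_wpM2r //.
    by rewrite mulr_ge0 // exprn_ge0 // ltW.
  by rewrite ler_pM2r // invr_gt0 mulr_gt0.
have DhL k : (k <= K.+1)%N -> D%:R * h * L ^+ k <= w * n * d ^+ 4 / 16.
  move=> /QL le_QL; apply: le_trans (_ : w * n * Q / 16 * L ^+ k <= _).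
    by rewrite ler_wpM2r // exprn_ge0 // ltW.
  have -> : w * n * Q / 16 * L ^+ k = w * n / 16 * (Q * L ^+ k) by ring.
  have -> : w * n * d ^+ 4 / 16 = w * n / 16 * d ^+ 4 by ring.
  by rewrite ler_wpM2l // divr_ge0.
have a1 : a <= 1 by lra.
have d4 : d ^+ 4 <= a ^+ 8 / 10.
  have -> : d ^+ 4 = a ^+ 8 * (a ^+ 2 * a ^+ 2) by rewrite dE; ring.
  rewrite ler_wpM2l ?exprn_ge0 ?(ltW a0) //.
  apply: le_trans (_ : 1 / 8 * (1 / 8) <= _); last by lra.
  by apply: ler_pM => //; exact: ltW.
have a8 : a ^+ 8 <= a ^+ 5.
  have -> : a ^+ 8 = a ^+ 5 * d by rewrite dE; ring.
  by rewrite ger_pMr ?exprn_gt0.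
split.
  have := DhL _ (leqnn K.+1); rewrite -/w -!mulrA => le1.
  have : w * n * d ^+ 4 <= w * n * (a ^+ 5 / 10) by rewrite ler_wpM2l //; lra.
  have : 0 <= w * n * a ^+ 5 by rewrite mulr_ge0 // exprn_ge0 // ltW.
  by lra.
rewrite ler_pdivrMr; last by rewrite divr_gt0 ?exprn_gt0.
(* Scaling by [a ^+ 2] turns [rs] into the bounded quantity [a ^+ 2 * rs]. *)
rewrite -(ler_pM2l s0).
have hL : h * L ^+ K <= n * a ^+ 8 / 160.
  apply: le_trans (_ : D%:R * h * L ^+ K <= _).
    by rewrite ler_wpM2r ?exprn_ge0 ?(ltW L0) // ler_peMl //; lra.
  apply: le_trans (DhL K (leqnSn K)) _.
  have : w * n * d ^+ 4 <= 1 * n * (a ^+ 8 / 10).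
    by apply: ler_pM; rewrite ?exprn_ge0 ?(ltW d0) // ler_wpM2r // ltW.
  by lra.
have LK0 : 0 <= L ^+ K by rewrite exprn_ge0 // ltW.
apply: le_trans (_ : 2 * (3 * (n * a ^+ 8 / 160)) <= _); last first.
  have -> : a ^+ 2 * (a * n * (a ^+ 5 / 6)) = n * a ^+ 8 / 6 by field.
  have : 0 <= n * a ^+ 8 by rewrite mulr_ge0 ?exprn_ge0 ?(ltW n0) ?(ltW a0).
  by lra.
have -> : a ^+ 2 * ((2 + h) * (rs + 2) * L ^+ K) =
  (a ^+ 2 * rs + 2 * a ^+ 2) * ((2 + h) * L ^+ K) by ring.
apply: ler_pM.
- by rewrite addr_ge0 ?mulr_ge0 // ltW.
- by rewrite mulr_ge0 //; lra.
- by lra.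
apply: le_trans (_ : 3 * (h * L ^+ K) <= _); last by rewrite ler_pM2l.
by rewrite mulrA ler_wpM2r //; lra.
Qed.

From mathcomp Require Import all_classical all_reals all_analysis.

Lemma expR_ln_inv (R : realType) (d x : R) (D : nat) : 0 < d ->
  expR (- ((D%:R + x) * ln (1 / d))) = d ^+ D * expR (- (x * ln (1 / d))).
Proof.
move=> d0; rewrite div1r lnV ?posrE // !mulrN !opprK mulrDl expRD expRM_natl.
by rewrite lnK ?posrE.
Qed.

Lemma expR_ln_inv_le (R : realType) (d x : R) (M : nat) : 0 < d -> d <= 1 ->
  M%:R <= x -> expR (- (x * ln (1 / d))) <= d ^+ M.
Proof.
move=> d0 d1 le_x; rewrite -{2}[d]lnK ?posrE // -expRM_natl ler_expR.
by rewrite div1r lnV ?posrE // mulrN opprK ler_wnM2r // ln_le0.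
Qed.

Theorem theorem4p4 (R : realType) (eps d rho : R) (G H : sgraph) (n h D : nat)
  (eps_gt0 : 0 < eps) (eps_lt : eps < 1 / 10)
  (d_ge : 20 * eps `^ (1 / 5) <= d) (d_lt : d < 1 / 3)
  (G_order : #|G| = n)
  (G_regular : regular_pm G rho (d ^+ 4 / 10 * rho))
  (rho_ge : 3 * d `^ (1 / 3) * n%:R <= rho)
  (H_order : #|H| = h) (H_bipartite : bipartite H)
  (H_max_degree : max_degree H = D) (D_ge1 : (1 <= D)%N)
  (n_gt : 2 * expR (150 * ln (1 / d) / eps ^+ 2) < n%:R)
  (h_le : h%:R <= eps `^ (1 / 5) / (16 * D%:R)
                  * expR (- ((D%:R + 101 / eps ^+ 2) * ln (1 / d)))
                  * 3 ^- D * n%:R) :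
  exists P : {set {ffun H -> G}},
    packing P /\
    #|(~: covered P)%SET|%:R <= 5 * d `^ (1 / 3) * n%:R.
Proof.
set e := eps `^ (1 / 5) in d_ge h_le.
have e0 : 0 < e by apply: powR_gt0.
have d0 : 0 < d by apply: lt_le_trans d_ge; rewrite mulr_gt0.
set a := d `^ (1 / 3) in rho_ge *.
have a0 : 0 < a by apply: powR_gt0.
have dE : d = a ^+ 3.
  by rewrite -powR_mulrn ?powR_ge0 // -powRrM mul1r mulVf // powRr1 // ltW.
have eE : eps = e ^+ 5.
  by rewrite -powR_mulrn ?powR_ge0 // -powRrM mul1r mulVf // powRr1 // ltW.
have n0 : 0 < n%:R :> R.
  by apply: le_lt_trans n_gt; rewrite mulr_ge0 ?expR_ge0.
have rho0 : 0 < rho by apply: lt_le_trans rho_ge; rewrite !mulr_gt0.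
have deg_c (x : G) : (1 - a ^+ 12 / 10) * rho <= (degree x)%:R <= (1 + a ^+ 12 / 10) * rho.
  have -> : a ^+ 12 = d ^+ 4 by rewrite dE; ring.
  by rewrite mulrBl mulrDl !mul1r; apply: G_regular.
(* No degree exceeds [n], while the minimum degree is at least [24 / 25 * (3 * a * n)]. *)
have a_le : a <= 7 / 20.
  have /card_gt0P[x _] : (0 < #|G|)%N by rewrite G_order -(ltr0n R).
  have le1 : (1 - a ^+ 12 / 10) * rho <= n%:R.
    have /andP[+ _] := deg_c x; move/le_trans; apply.
    by rewrite ler_nat -G_order max_card.
  have t1 : a ^+ 12 <= d.
    have -> : a ^+ 12 = d * d ^+ 3 by rewrite dE; ring.
    by rewrite ger_pMr // exprn_ile1 ?ltW //; lra.
  have le2 : 24 / 25 * (3 * a * n%:R) <= (1 - a ^+ 12 / 10) * rho.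
    apply: ler_pM; [by lra| |by lra|exact: rho_ge].
    by rewrite !mulr_ge0 // ltW.
  have : 24 / 25 * (3 * a) <= 1 by rewrite -(ler_pM2r n0); lra.
  by lra.
have d3 : 3 * d <= 1 by lra.
(* [rs] is the mean cover, just above [d ^ (-2/3)]; [1 / L] is the relative size at which regularity
   is tested; [K] bounds the number of density increments. *)
pose rs := (Num.truncn (a ^+ 2)^-1).+1.
pose L := (Num.truncn (2 / d)).+1.
pose K := (Num.truncn (2 * L%:R ^+ 2 / d)).+1.
have s0 : 0 < a ^+ 2 by rewrite exprn_gt0.
have rs1 : 1 <= a ^+ 2 * rs%:R.
  by rewrite mulrC -ler_pdivrMr // div1r ltW // truncnS_gt.
have rs2 : a ^+ 2 * rs%:R <= 1 + a ^+ 2.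
  rewrite -natr1 mulrDr mulr1 lerD2r mulrC -ler_pdivlMr // div1r.
  by rewrite truncn_le invr_ge0 ltW.
have [L4 leK leLd leKd] : [/\ 4 <= L%:R :> R, 2 * L%:R ^+ 2 <= K%:R * d,
    L%:R * d ^+ 2 <= 1 & (2 * K%:R + 6) * d ^+ 3 <= 101].
  apply: size_bounds => //; try exact: truncnS_gt.
    by rewrite -[L%:R]natr1 lerD2r truncn_le divr_ge0 // ltW.
  by rewrite -[K%:R]natr1 lerD2r truncn_le divr_ge0 ?mulr_ge0 ?sqr_ge0 // ltW.
have le_dn : 3 * (d * n%:R) <= a ^+ 2 * rho.
  have -> : 3 * (d * n%:R) = a ^+ 2 * (3 * a * n%:R) by rewrite dE; ring.
  by rewrite ler_pM2l.
have [lo0 le_hi] := light_bound a0 a_le rho0 (mulr_ge0 (ltW d0) (ltW n0)) le_dn (ler0n R rs).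
have leQ : expR (- (101 / eps ^+ 2 * ln (1 / d))) <= d ^+ (2 * K + 6).
  apply: expR_ln_inv_le => //; first by lra.
  rewrite natrD natrM ler_pdivlMr ?exprn_gt0 //; apply: le_trans leKd.
  (* Since [K] has order [d ^ (-3)], this makes [101 / eps ^+ 2] exceed the exponent [2 * K + 6]. *)
  have eps_d : eps <= d ^+ 2.
    have ed : e <= d by lra.
    rewrite eE; apply: le_trans (_ : d ^+ 5 <= _).
      by apply: lerXn2r; rewrite ?nnegrE // ltW.
    rewrite (exprD d 2 3) ger_pMr ?exprn_gt0 // exprn_ile1 ?ltW //; lra.
  rewrite ler_wpM2l ?addr_ge0 ?mulr_ge0 //.
  apply: le_trans (_ : (d ^+ 2) ^+ 2 <= _).
    by apply: lerXn2r; rewrite ?nnegrE ?sqr_ge0 // ltW.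
  by rewrite -exprM (exprS d 3) ger_pMl ?exprn_gt0 //; lra.
have h0 : (0 < h)%N.
  rewrite -H_order lt0n; apply/eqP => H0; move: D_ge1.
  rewrite -H_max_degree /max_degree big1 // => x _.
  by have /card0_eq/(_ x) := H0.
have e1 : e <= 1 by lra.
have h1 : 1 <= h%:R :> R by rewrite ler1n.
have L0 : 0 < L%:R :> R by rewrite ltr0n.
rewrite expR_ln_inv // in h_le.
have [le_hL le_h] : 8 * D%:R * h%:R * L%:R ^+ K.+1 <= (d / 3) ^+ D * (a ^+ 5 / 6 * n%:R) /\
    (2 + h%:R) * (rs%:R + 2) * L%:R ^+ K / (a ^+ 5 / 6) <= a * n%:R.
  move: h_le leLd leQ; rewrite dE => h_le leLd leQ.
  exact: order_bounds a0 a_le (ltW e0) e1 D_ge1 h1 n0 L0 leLd (expR_ge0 _) leQ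
    (ler0n R rs) rs2 h_le.
have degD (x : H) : (degree x <= D)%N by rewrite -H_max_degree; apply: leq_bigmax.
(* The variance condition for [b = 2 * a] reduces to [1 <= a ^+ 2 * rs]. The three leftover terms
   are then at most [2 * a * n], [a * n] and [a * n]. *)
have [||||||||||||||||||k [P [packP _ le_P]] le_k] := @bipartite_tiling R G H
  ((1 - a ^+ 12 / 10) * rho) ((1 + a ^+ 12 / 10) * rho) d (a ^+ 5 / 6)
  (a ^+ 2 * rs%:R) (2 * a) rs L K D; rewrite ?G_order ?H_order //.
- by rewrite -(ltr0n R).
- by rewrite divr_gt0 ?exprn_gt0.
- by rewrite mulr_ge0 // ltW.
- by rewrite mulr_gt0.
- by rewrite -(ler_nat R).
- by rewrite dE; apply: level_bound.
- by move: lo0; rewrite mulrA.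
- by move: le_hi; rewrite mulrA.
- by rewrite exprMn; move: rs1; clear; lra.
- by rewrite !natrM.
exists P; split=> //; rewrite -finset.setTD.
apply: le_trans (_ : k%:R <= _); first by rewrite ler_nat.
apply: le_trans le_k _; rewrite G_order H_order.
have -> : (rs + 2)%:R = rs%:R + 2 :> R by rewrite natrD.
have -> : (2 + h)%:R = 2 + h%:R :> R by rewrite natrD.
have : (rs%:R + 2) * n%:R / L%:R <= a * n%:R.
  rewrite mulrAC ler_pM2r // ler_pdivrMr //.
  have Ld : 2 <= L%:R * d by rewrite -ler_pdivrMr // ltW // truncnS_gt.
  have s1 := sq_bound a0 a_le; rewrite -(ler_pM2l s0).
  have -> : a ^+ 2 * (a * L%:R) = L%:R * d by rewrite dE; ring.
  by lra.
move: le_h; move: (_ / (a ^+ 5 / 6)) (_ / L%:R) => u v le_h le_v.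
have : 0 < a * n%:R by rewrite mulr_gt0.
by lra.
Qed.
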